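(* For any positive integers $a,b$ and all sufficiently large $n$, there is an integer $m$ such that $\mathrm{ex}(n,S_{a,b},F_2)=\mathcal{N}(S_{a,b},K_{m,n-m}^+)$.
   Context: The double star $S_{a,b}$ is the tree consisting of an edge $uv$, $a$ leaves adjacent to $u$ and $b$ leaves adjacent to $v$. $F_2$ (the 2-fan) is the graph consisting of two triangles sharing exactly one vertex. $K_{s,t}^+$ denotes the graph obtained from the complete bipartite graph $K_{s,t}$ by adding one edge inside the part of size $s$. $\mathcal{N}(H,G)$ is the number of copies of $H$ in $G$, and $\mathrm{ex}(n,H,F)$ is the maximum of $\mathcal{N}(H,G)$ over all $n$-vertex graphs $G$ containing no copy of $F$. *)

(* Defs.v *)
From HB Require Import structures.
From mathcomp Require Import all_boot.

Set Implicit Arguments.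
Unset Strict Implicit.
Unset Printing Implicit Defensive.

(** A finite simple graph with vertex set [T]: a set of two-element subsets
    of [T]. *)
Record sgraph (T : finType) := SGraph {
  edges : {set {set T}};
  edges_card2 : [forall e in edges, #|e| == 2]
}.

HB.instance Definition _ (T : finType) := [isSub for @edges T].
HB.instance Definition _ (T : finType) := [Finite of sgraph T by <:].

Lemma edges_of_subproof (T : finType) (r : rel T) :
  [forall e in [set [set x; y] | x in T, y in T & (x != y) && r x y],
     #|e| == 2].
Proof.
apply/forall_inP => e /imset2P[x y _]; rewrite inE => /andP[_ /andP[xy _]] ->.
by rewrite cards2 xy.
Qed.

(** The relation [r] need only hold in one of the two orientations of an
    edge, and loops are discarded. *)
Definition graph_of_rel (T : finType) (r : rel T) : sgraph T :=
  SGraph (edges_of_subproof r).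

(** Not necessarily induced subgraphs of [G], as pairs
    (vertex set, edge set). *)
Definition subgraph (T : finType) (G : sgraph T)
    (K : {set T} * {set {set T}}) : bool :=
  (K.2 \subset edges G) && [forall e in K.2, e \subset K.1].

Definition isomorphic_to (S T : finType) (H : sgraph S)
    (K : {set T} * {set {set T}}) : bool :=
  [exists f : {ffun S -> T},
    [&& injectiveb f, K.1 == f @: [set: S]
      & K.2 == [set f @: (e : {set S}) | e in edges H]]].

Definition copies (S T : finType) (H : sgraph S) (G : sgraph T) :
    {set {set T} * {set {set T}}} :=
  [set K | subgraph G K && isomorphic_to H K].

Definition num_copies (S T : finType) (H : sgraph S) (G : sgraph T) : nat :=
  #|copies H G|.

Definition graph_free (S T : finType) (F : sgraph S) (G : sgraph T) : bool :=
  copies F G == set0.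

Definition ex_copies (n : nat) (S S' : finType)
    (H : sgraph S) (F : sgraph S') : nat :=
  \max_(G : sgraph 'I_n | graph_free F G) num_copies H G.

(** The centres are [inl None] and [inr None]. *)
Definition double_star (a b : nat) : sgraph (option 'I_a + option 'I_b)%type :=
  graph_of_rel (fun x y : option 'I_a + option 'I_b =>
    match x, y with
    | inl None, inr None => true
    | inl None, inl (Some _) => true
    | inr None, inr (Some _) => true
    | _, _ => false
    end).

(** [None] is the common vertex; the triangle with index [i : bool] is
    [None], [Some (i, false)], [Some (i, true)]. *)
Definition two_fan : sgraph (option (bool * bool)) :=
  graph_of_rel (fun x y : option (bool * bool) =>
    match x, y with
    | None, Some _ => true
    | Some (i, _), Some (j, _) => i == j
    | _, _ => false
    end).

(** The extra edge joins vertices 0 and 1 of the part of size [s]; it exists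
    only if [2 <= s]. *)
Definition bipartite_plus (s t : nat) : sgraph ('I_s + 'I_t)%type :=
  graph_of_rel (fun x y : 'I_s + 'I_t =>
    match x, y with
    | inl _, inr _ => true
    | inl i, inl j => (i == 0 :> nat) && (j == 1 :> nat)
    | _, _ => false
    end).

(* Main.v *)
Require Import Defs.
From mathcomp Require Import all_boot.
From mathcomp Require Import zify.

Set Implicit Arguments.
Unset Strict Implicit.
Unset Printing Implicit Defensive.

(** Counting copies of [S_{a,b}] amounts to counting its embeddings, a fixed
    multiple. Let [G] be [F_2]-free on [n] vertices. A minimum set [M] of edges
    meeting all triangles of [G] is a matching, so [G0 = G - M] is triangle-free
    and [G] has at most [O(|M| n^(a+b))] more embeddings than [G0].

    Let [v0] have maximum degree [D] in [G0], [I] its (independent)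
    neighbourhood and [R] the complement of [I]. Adjacent vertices of [G0] have
    degree sum at most [n]; charging the embeddings of [G0] to the vertices of
    [R] bounds their number by [(1 - p / (3 n (n - D))) O], where [O] is the
    maximum over [m] of the count for [K_{m,n-m}] and [p] is the number of
    missing edges between [R] and [I]. Since [O] has order [n^(a+b+2)], [G]
    cannot beat [O] when [p] is of order [n |M|].

    As [G] has no [F_2], two edges of [M] inside [I] (or [R]) have no common
    neighbour, and an edge of [M] between [I] and [R] creates an edge of [G0]
    inside [R]; both force [p] to be of order [n |M|]. What remains is a
    spanning subgraph of [K_{m,n-m}^+], or of [K_{m,n-m}] plus one edge [xy] in
    [I] and one edge [x'y'] in [R]. In the latter case excluding [F_2] forces
    two disjoint missing edges, say [xx'] and [yy'], so all degrees are at most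
    those in [K_{m,n-m}], and the count is below that of [K_{m,n-m}^+] with the
    extra edge in the smaller part. *)

(** * Adjacency *)

Definition adj (T : finType) (G : sgraph T) : rel T :=
  fun x y => [set x; y] \in edges G.

Lemma adj_sym (T : finType) (G : sgraph T) : symmetric (adj G).
Proof. by move=> x y; rewrite /adj setUC. Qed.

Lemma adj_irr (T : finType) (G : sgraph T) : irreflexive (adj G).
Proof.
move=> x; apply/negP; rewrite /adj setUid => Gx.
by have := forall_inP (edges_card2 G) _ Gx; rewrite cards1.
Qed.

Lemma set2_eq (T : finType) (x y u v : T) :
  [set x; y] = [set u; v] -> (x = u /\ y = v) \/ (x = v /\ y = u).
Proof.
move=> E.
have := set21 x y; rewrite E => /set2P xuv.
have := set22 x y; rewrite E => /set2P yuv.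
have := set21 u v; rewrite -E => /set2P uxy.
have := set22 u v; rewrite -E => /set2P vxy.
by case: xuv yuv uxy vxy => [?|?] [?|?] [?|?] [?|?]; subst; auto.
Qed.

Lemma adj_graph_of_rel (T : finType) (r : rel T) x y :
  adj (graph_of_rel r) x y = (x != y) && (r x y || r y x).
Proof.
rewrite /adj /=; apply/imset2P/idP => [[u v _ + +] | /andP[xy]].
  rewrite inE => /andP[uv ruv] /set2_eq[[-> ->]|[-> ->]].
    by rewrite uv ruv.
  by rewrite eq_sym uv ruv orbT.
case/orP=> r1; first by exists x y; rewrite // inE xy r1.
by exists y x; rewrite ?inE 1?eq_sym ?xy ?r1 // setUC.
Qed.

(** * Copies and embeddings *)

Definition embeddings (S T : finType) (H : sgraph S) (G : sgraph T) :
    {set {ffun S -> T}} :=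
  [set f : {ffun S -> T} | injectiveb f
    && [forall E in edges H, f @: (E : {set S}) \in edges G]].

Definition image_graph (S T : finType) (H : sgraph S) (f : {ffun S -> T}) :=
  (f @: [set: S], [set f @: (E : {set S}) | E in edges H]).

Lemma copiesE (S T : finType) (H : sgraph S) (G : sgraph T) :
  copies H G = image_graph H @: embeddings H G.
Proof.
apply/setP => K; rewrite inE; apply/andP/imsetP => [[sK]|[f]].
  case/existsP=> f /and3P[inj_f /eqP K1 /eqP K2]; exists f; last first.
    by rewrite /image_graph -K1 -K2; case: (K).
  rewrite inE inj_f; apply/forall_inP => E HE.
  case/andP: sK => /subsetP sK _; apply: sK.
  by rewrite K2; apply: imset_f.
rewrite inE => /andP[inj_f /forall_inP Gf] ->; split; last first.
  by apply/existsP; exists f; rewrite inj_f /= !eqxx.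
apply/andP; split => /=.
  by apply/subsetP => E' /imsetP[E HE ->]; apply: Gf.
by apply/forall_inP => E' /imsetP[E HE ->]; apply: imsetS; apply: subsetT.
Qed.

Definition automorphisms (S : finType) (H : sgraph S) : {set {ffun S -> S}} :=
  [set f : {ffun S -> S} | injectiveb f
    && ([set f @: (E : {set S}) | E in edges H] == edges H)].

Lemma automorphisms_gt0 (S : finType) (H : sgraph S) : 0 < #|automorphisms H|.
Proof.
apply/card_gt0P; exists [ffun x => x]; rewrite inE.
have idE (A : {set S}) : [ffun x : S => x] @: A = A.
  rewrite -[RHS]imset_id; apply: eq_imset => x; by rewrite ffunE.
apply/andP; split; first by apply/injectiveP => x y; rewrite !ffunE.
by apply/eqP; rewrite -[RHS]imset_id; apply: eq_imset => A; rewrite idE.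
Qed.

(** Composition with [f0] maps the automorphisms of [H] bijectively onto the embeddings with the
    same image as [f0]. *)
Lemma card_image_graph_fiber (S T : finType) (H : sgraph S) (G : sgraph T) f0 :
  f0 \in embeddings H G ->
  #|[set f in embeddings H G | image_graph H f == image_graph H f0]|
    = #|automorphisms H|.
Proof.
rewrite inE => /andP[/injectiveP inj0 /forall_inP Gf0].
pose c (s : {ffun S -> S}) : {ffun S -> T} := [ffun x => f0 (s x)].
have cvE s x : c s x = f0 (s x) by rewrite ffunE.
have inj_c : injective c.
  move=> s t /ffunP st; apply/ffunP => x; apply: inj0.
  by have := st x; rewrite !ffunE.
have cE s (A : {set S}) : c s @: A = f0 @: (s @: A).
  by rewrite -imset_comp; apply: eq_imset => x; rewrite ffunE.
rewrite -(card_imset _ inj_c); apply: eq_card => f; rewrite inE.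
apply/andP/imsetP => [[]|[s]].
  rewrite inE => /andP[/injectiveP inj_f /forall_inP Gf] /eqP[E1 E2].
  (* Equal vertex images let [f] factor through [f0]; equal edge images then make the factor an
     automorphism. *)
  have f0P x : {y | f x == f0 y}.
    apply: sigW; have : f x \in f @: setT by apply: imset_f.
    by rewrite E1 => /imsetP[y _ ->]; exists y.
  pose s : {ffun S -> S} := [ffun x => sval (f0P x)].
  have fE : f = c s.
    by apply/ffunP => x; rewrite !ffunE; exact/eqP/(svalP (f0P x)).
  exists s => //; rewrite inE; apply/andP; split.
    apply/injectiveP => x y sxy; apply: inj_f.
    by rewrite fE !cvE sxy.
  have injI := imset_inj inj0.
  apply/eqP; apply: (imset_inj injI); rewrite -E2 -imset_comp.
  by apply: eq_imset => A /=; rewrite fE cE.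
rewrite inE => /andP[/injectiveP inj_s /eqP Hs] ->.
have E2 : [set c s @: (E : {set S}) | E in edges H]
    = [set f0 @: (E : {set S}) | E in edges H].
  by rewrite -[in RHS]Hs -imset_comp; apply: eq_imset => A /=; rewrite cE.
split; last first.
  have sT : s @: [set: S] = setT.
    by apply/eqP; rewrite eqEcard subsetT /= card_imset.
  by rewrite /image_graph E2 cE sT.
rewrite inE; apply/andP; split.
  by apply/injectiveP => x y; rewrite !ffunE => /inj0/inj_s.
apply/forall_inP => E HE.
have : c s @: E \in [set c s @: (E : {set S}) | E in edges H] by apply: imset_f.
by rewrite E2 => /imsetP[E' HE' ->]; apply: Gf0.
Qed.

(** The factor depends on [H] alone, so copies in two host graphs can be compared through
    embeddings. *)
Lemma card_embeddings (S T : finType) (H : sgraph S) (G : sgraph T) :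
  #|embeddings H G| = #|automorphisms H| * num_copies H G.
Proof.
rewrite -sum1_card (partition_big_imset (image_graph H)) /= -copiesE mulnC.
rewrite -sum_nat_const; apply: eq_bigr => K.
rewrite copiesE => /imsetP[f0 Hf0 ->].
by rewrite -(card_image_graph_fiber Hf0) sum1dep_card.
Qed.

Lemma card_eq_bij (T T' : finType) :
  #|T| = #|T'| -> {f : T -> T' | bijective f}.
Proof.
move=> E; exists (fun x => enum_val (cast_ord E (enum_rank x))).
exists (fun y => enum_val (cast_ord (esym E) (enum_rank y))) => x.
  by rewrite enum_valK cast_ordK enum_rankK.
by rewrite enum_valK cast_ordKV enum_rankK.
Qed.

Lemma graph_free_two_fan (T : finType) (G : sgraph T) z x y x' y' :
  graph_free two_fan G -> uniq [:: z; x; y; x'; y'] ->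
  adj G z x -> adj G z y -> adj G x y ->
  adj G z x' -> adj G z y' -> adj G x' y' -> False.
Proof.
move=> /eqP free; rewrite /= !inE !negb_or.
case/and5P=> /and4P[zx zy zx' zy'] /and3P[xy xx' xy'] /andP[yx' yy'] x'y' _.
move=> ezx ezy exy ezx' ezy' ex'y'.
pose f : {ffun option (bool * bool) -> T} := [ffun s => match s with
  | None => z | Some (i, j) => if i then (if j then x' else y')
                               else (if j then x else y) end].
suff : f \in embeddings two_fan G.
  by move/(imset_f (image_graph two_fan)); rewrite -copiesE free inE.
rewrite inE; apply/andP; split.
  apply/injectiveP => s t; rewrite !ffunE.
  case: s => [[[] []]|]; case: t => [[[] []]|] //= E;
    move: E zx zy zx' zy' xy xx' xy' yx' yy' x'y';
    by (move=> -> || move=> <-); rewrite ?eqxx.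
apply/forall_inP => E /imset2P[s t _]; rewrite inE => /andP[_ /andP[st r]] ->.
rewrite imsetU1 imset_set1 !ffunE -/(adj G _ _).
case: s st r => [[[] []]|]; case: t => [[[] []]|] //= _ _; by rewrite // adj_sym.
Qed.

Lemma two_fan_graph_free (T : finType) (G : sgraph T) :
  (forall z x y x' y', uniq [:: z; x; y; x'; y'] ->
   adj G z x -> adj G z y -> adj G x y ->
   adj G z x' -> adj G z y' -> adj G x' y' -> False) ->
  graph_free two_fan G.
Proof.
move=> noF; rewrite /graph_free copiesE; apply/eqP/setP => K; rewrite [RHS]inE.
apply/negP => /imsetP[f]; rewrite inE => /andP[/injectiveP inj_f /forall_inP Gf] _.
have ef s t : adj two_fan s t -> adj G (f s) (f t).
  by move=> st; have := Gf _ st; rewrite imsetU1 imset_set1.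
pose F := [:: None; Some (false, false); Some (false, true);
  Some (true, false); Some (true, true)] : seq (option (bool * bool)).
have uF : uniq [seq f s | s <- F] by rewrite map_inj_uniq.
by apply: noF uF _ _ _ _ _ _; apply: ef; rewrite adj_graph_of_rel.
Qed.

(** * Embeddings of double stars *)

Definition star_rel (a b : nat) (x y : option 'I_a + option 'I_b) : bool :=
  match x, y with
  | inl None, inr None => true
  | inl None, inl (Some _) => true
  | inr None, inr (Some _) => true
  | _, _ => false
  end.

(** Taken over an arbitrary relation, because it is also applied to a graph with a matching deleted,
    which is never packaged as an [sgraph]. *)
Definition star_embeddings (a b : nat) (T : finType) (e : rel T) :
    {set {ffun option 'I_a + option 'I_b -> T}} :=
  [set f : {ffun option 'I_a + option 'I_b -> T} | injectiveb f
    && [forall s, forall t, star_rel s t ==> e (f s) (f t)]].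

Lemma embeddings_double_star a b (T : finType) (G : sgraph T) :
  embeddings (double_star a b) G = star_embeddings a b (adj G).
Proof.
apply/setP => f; rewrite !inE; congr andb; apply/forall_inP/forallP => Gf.
  move=> s; apply/forallP => t; apply/implyP => st.
  have : [set s; t] \in edges (double_star a b).
    rewrite -/(adj (double_star a b) s t) adj_graph_of_rel -/(star_rel s t) st /=.
    by rewrite andbT; case: s st => [[?|]|[?|]]; case: t => [[?|]|[?|]].
  by move/Gf; rewrite imsetU1 imset_set1.
move=> E /imset2P[s t _]; rewrite inE => /andP[_ /andP[_ st]] ->.
rewrite imsetU1 imset_set1.
by have /forallP/(_ t)/implyP := Gf s; apply.
Qed.

Section StarCount.

Variables (a b : nat) (T : finType).
Implicit Types (e : rel T) (u v : T).

Local Notation S := (option 'I_a + option 'I_b)%type.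

Definition star_count e := #|star_embeddings a b e|.

Definition deg e u := #|[set w | e u w]|.

(* The number of ways to attach ordered leaves to an edge whose ends have
   degrees [x] and [y] and no common neighbour; [gsum] sums both orientations. *)
Definition phi (x y : nat) := x.-1 ^_ a * y.-1 ^_ b.

Definition star_fiber e u v :=
  [set f in star_embeddings a b e | (f (inl None) == u) && (f (inr None) == v)].

Lemma star_embeddingsP e (f : {ffun S -> T}) :
  reflect [/\ injective f, e (f (inl None)) (f (inr None)),
              forall i, e (f (inl None)) (f (inl (Some i))) &
              forall j, e (f (inr None)) (f (inr (Some j)))]
          (f \in star_embeddings a b e).
Proof.
rewrite inE; apply: (iffP andP) => [[/injectiveP inj_f /forallP ef]|[inj_f euv eu ev]].
  have {}ef s t : star_rel s t -> e (f s) (f t).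
    by have /forallP/(_ t)/implyP := ef s.
  by split=> // *; apply: ef.
split; first exact/injectiveP.
apply/forallP => s; apply/forallP => t; apply/implyP.
by case: s => [[?|]|[?|]]; case: t => [[?|]|[?|]].
Qed.

Lemma star_countE e : star_count e = \sum_u \sum_v #|star_fiber e u v|.
Proof.
rewrite /star_count -sum1_card.
rewrite (partition_big (fun f : {ffun S -> T} => f (inl None)) predT) //=.
apply: eq_bigr => u _.
rewrite (partition_big (fun f : {ffun S -> T} => f (inr None)) predT) //=.
by apply: eq_bigr => v _; rewrite sum1dep_card; apply: eq_card => f; rewrite !inE andbA.
Qed.

(** With the centres fixed, an embedding amounts to two injections of the leaves into the
    neighbourhoods, each without the opposite centre. Disjointness of their images is dropped, hence
    only an upper bound. *)
Lemma star_fiber_le e u v : symmetric e ->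
  #|star_fiber e u v| <= if e u v then phi (deg e u) (deg e v) else 0.
Proof.
move=> sym_e; case: ifP => euv; last first.
  rewrite leqn0 cards_eq0; apply/eqP/setP => f; rewrite [RHS]inE inE.
  apply/negP => /andP[/star_embeddingsP[_ h _ _] /andP[/eqP f1 /eqP f2]].
  by rewrite f1 f2 euv in h.
pose d (f : {ffun S -> T}) :=
  ([ffun i => f (inl (Some i))] : {ffun 'I_a -> T},
   [ffun j => f (inr (Some j))] : {ffun 'I_b -> T}).
have inj_d : {in star_fiber e u v &, injective d}.
  move=> f g; rewrite 2!inE => /andP[_ /andP[/eqP f1 /eqP f2]].
  rewrite 2!inE => /andP[_ /andP[/eqP g1 /eqP g2]] [/ffunP E1 /ffunP E2].
  apply/ffunP => -[[i|]|[j|]]; rewrite ?f1 ?f2 ?g1 ?g2 //.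
    by have := E1 i; rewrite !ffunE.
  by have := E2 j; rewrite !ffunE.
rewrite -(card_in_imset inj_d).
have -> : phi (deg e u) (deg e v) = #|setX
    [set f in ffun_on [set w | e u w & w != v] | injectiveb (f : {ffun 'I_a -> T})]
    [set f in ffun_on [set w | e v w & w != u] | injectiveb (f : {ffun 'I_b -> T})]|.
  rewrite cardsX !card_inj_ffuns_on !card_ord /phi /deg.
  rewrite (cardsD1 v [set w | e u w]) (cardsD1 u [set w | e v w]) !inE euv sym_e euv /=.
  by congr (_ ^_ _ * _ ^_ _); apply: eq_card => w; rewrite !inE andbC.
apply: subset_leq_card; apply/subsetP => _ /imsetP[f + ->].
rewrite inE => /andP[/star_embeddingsP[inj_f _ eu ev] /andP[/eqP f1 /eqP f2]].
rewrite f1 in eu; rewrite f2 in ev.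
rewrite !inE /= -!andbA; apply/and4P; split.
- apply/ffun_onP => i; rewrite ffunE inE eu /= -f2.
  by apply: contra_eqN (erefl true) => /eqP/inj_f.
- by apply/injectiveP => i j; rewrite !ffunE => /inj_f[].
- apply/ffun_onP => i; rewrite ffunE inE ev /= -f1.
  by apply: contra_eqN (erefl true) => /eqP/inj_f.
- by apply/injectiveP => i j; rewrite !ffunE => /inj_f[].
Qed.

Lemma star_count_le e : symmetric e ->
  star_count e <= \sum_u \sum_(v | e u v) phi (deg e u) (deg e v).
Proof.
move=> sym_e; rewrite star_countE; apply: leq_sum => u _.
rewrite [leqRHS]big_mkcond; apply: leq_sum => v _; exact: star_fiber_le.
Qed.

Lemma star_fiber_ge_disjoint e u v (A B : {set T}) :
  e u v -> u != v -> [disjoint A & B] -> u \notin B -> v \notin A ->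
  (forall w, w \in A -> e u w /\ u != w) ->
  (forall w, w \in B -> e v w /\ v != w) ->
  #|A| ^_ a * #|B| ^_ b <= #|star_fiber e u v|.
Proof.
move=> euv uv /pred0P dAB uB vA eA eB.
pose c (p : {ffun 'I_a -> T} * {ffun 'I_b -> T}) : {ffun S -> T} :=
  [ffun s => match s with inl None => u | inl (Some i) => p.1 i
    | inr None => v | inr (Some j) => p.2 j end].
have inj_c : injective c.
  move=> [f h] [f' h'] /ffunP E; congr pair; apply/ffunP => i.
    by have := E (inl (Some i)); rewrite !ffunE.
  by have := E (inr (Some i)); rewrite !ffunE.
have -> : #|A| ^_ a * #|B| ^_ b = #|setX
    [set f in ffun_on A | injectiveb (f : {ffun 'I_a -> T})]
    [set f in ffun_on B | injectiveb (f : {ffun 'I_b -> T})]|.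
  by rewrite cardsX !card_inj_ffuns_on !card_ord.
rewrite -(card_imset _ inj_c).
apply: subset_leq_card; apply/subsetP => _ /imsetP[[f h] Hf ->].
rewrite !inE /= -!andbA in Hf.
case/and4P: Hf => [/ffun_onP fA /injectiveP inj_f /ffun_onP hB /injectiveP inj_h].
have fu i : f i != u by rewrite eq_sym; case: (eA _ (fA i)).
have hv i : h i != v by rewrite eq_sym; case: (eB _ (hB i)).
have fv i : f i != v by apply: contraNneq vA => <-.
have hu i : h i != u by apply: contraNneq uB => <-.
have fh i j : f i != h j.
  by apply/eqP => E; have := dAB (f i); rewrite /= fA E hB.
rewrite inE !ffunE !eqxx !andbT.
apply/star_embeddingsP; rewrite !ffunE; split=> //.
- move=> [[i|]|[j|]] [[i'|]|[j'|]]; rewrite !ffunE /= => E //.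
  + by rewrite (inj_f _ _ E).
  + by have := fu i; rewrite E eqxx.
  + by have := fh i j'; rewrite E eqxx.
  + by have := fv i; rewrite E eqxx.
  + by have := fu i'; rewrite -E eqxx.
  + by have := hu j'; rewrite -E eqxx.
  + by rewrite E eqxx in uv.
  + by have := fh i' j; rewrite -E eqxx.
  + by have := hu j; rewrite E eqxx.
  + by rewrite (inj_h _ _ E).
  + by have := hv j; rewrite E eqxx.
  + by have := fv i'; rewrite -E eqxx.
  + by rewrite -E eqxx in uv.
  + by have := hv j'; rewrite -E eqxx.
- by move=> i; rewrite ffunE; case: (eA _ (fA i)).
- by move=> i; rewrite ffunE; case: (eB _ (hB i)).
Qed.

(** Serves the extra edge of [bipartite_plus], whose ends share the whole other part: a single
    injection places all [a + b] leaves. *)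
Lemma star_fiber_ge_common e u v (A : {set T}) :
  e u v -> u != v -> u \notin A -> v \notin A ->
  (forall w, w \in A -> e u w /\ e v w) ->
  #|A| ^_ (a + b) <= #|star_fiber e u v|.
Proof.
move=> euv uv uA vA eA.
pose c (p : {ffun 'I_a + 'I_b -> T}) : {ffun S -> T} :=
  [ffun s => match s with inl None => u | inl (Some i) => p (inl i)
    | inr None => v | inr (Some j) => p (inr j) end].
have inj_c : injective c.
  move=> f f' /ffunP E; apply/ffunP => -[] i.
    by have := E (inl (Some i)); rewrite !ffunE.
  by have := E (inr (Some i)); rewrite !ffunE.
have -> : #|A| ^_ (a + b) =
    #|[set f in ffun_on A | injectiveb (f : {ffun 'I_a + 'I_b -> T})]|.
  by rewrite card_inj_ffuns_on card_sum !card_ord.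
rewrite -(card_imset _ inj_c).
apply: subset_leq_card; apply/subsetP => _ /imsetP[f Hf ->].
rewrite !inE in Hf; case/andP: Hf => [/ffun_onP fA /injectiveP inj_f].
have fu i : f i != u by apply: contraNneq uA => <-.
have fv i : f i != v by apply: contraNneq vA => <-.
rewrite inE !ffunE !eqxx !andbT.
apply/star_embeddingsP; rewrite !ffunE; split=> //.
- move=> [[i|]|[j|]] [[i'|]|[j'|]]; rewrite !ffunE /= => E //;
    try (by case/inj_f: E => ->); try (by have /inj_f := E);
    by [ have := fu (inl i); rewrite E eqxx | have := fv (inl i); rewrite E eqxx
       | have := fu (inl i'); rewrite -E eqxx | have := fv (inl i'); rewrite -E eqxx
       | have := fu (inr j); rewrite E eqxx | have := fv (inr j); rewrite E eqxx
       | have := fu (inr j'); rewrite -E eqxx | have := fv (inr j'); rewrite -E eqxx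
       | rewrite E eqxx in uv | rewrite -E eqxx in uv ].
- by move=> i; rewrite ffunE; case: (eA _ (fA (inl i))).
- by move=> i; rewrite ffunE; case: (eA _ (fA (inr i))).
Qed.

(** Indexes the [a + b + 1] edges of the double star, with [None] for the central one. *)
Definition star_edge (q : option ('I_a + 'I_b)) : S * S :=
  match q with
  | None => (inl None, inr None)
  | Some (inl i) => (inl None, inl (Some i))
  | Some (inr j) => (inr None, inr (Some j))
  end.

Lemma card_ffun_fix2 (s t : S) (x y : T) : s != t ->
  #|[set f : {ffun S -> T} | (f s == x) && (f t == y)]| <= #|T| ^ (a + b).
Proof.
move=> st.
(* The two prescribed vertices have singleton ranges, the other [a + b] range over [T];
   [card_family] multiplies the sizes. *)
pose F (z : S) : pred T := if z == s then pred1 x else if z == t then pred1 y else predT.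
have sub : [set f : {ffun S -> T} | (f s == x) && (f t == y)] \subset family F.
  apply/subsetP => f; rewrite inE => /andP[fs ft]; apply/familyP => z.
  rewrite /F; case: eqP => [->|_]; first by rewrite inE.
  by case: eqP => [->|_]; rewrite inE.
apply: leq_trans (subset_leq_card sub) _; rewrite card_family.
rewrite foldrE big_map big_enum /= (bigD1 s) //= (bigD1 t) ?(eq_sym t) //=.
rewrite /F !eqxx eq_sym (negPf st) !card1 !mul1n.
rewrite (eq_bigr (fun=> #|T|)); last first.
  by move=> z /andP[/negPf-> /negPf->].
have cardS := cardsC [set s; t].
rewrite cards2 st card_sum !card_option !card_ord in cardS.
rewrite prod_nat_const (_ : #|_| = a + b) //.
suff -> : #|[pred z | z != s & z != t]| = #|~: [set s; t]| by lia.
by apply: eq_card => z; rewrite !inE negb_or.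
Qed.

(** An embedding for [e] that is not one for [e0] sends some edge of the double star to an ordered
    pair lost in [e0]. This choice fixes two vertices and leaves [a + b] free. *)
Lemma star_count_perturb e e0 :
  star_count e <= star_count e0
    + (a + b).+1 * #|[set xy | e xy.1 xy.2 & ~~ e0 xy.1 xy.2]| * #|T| ^ (a + b).
Proof.
set B := [set xy | _ & _].
pose X (qp : option ('I_a + 'I_b) * (T * T)) :=
  [set f : {ffun S -> T} | (f (star_edge qp.1).1 == qp.2.1)
                        && (f (star_edge qp.1).2 == qp.2.2)].
have sub : star_embeddings a b e \subset
    star_embeddings a b e0 :|: \bigcup_(qp in setX setT B) X qp.
  apply/subsetP => f ef; rewrite in_setU; apply/orP.
  have [inj_f euv eu ev] := star_embeddingsP _ _ ef.
  have [/existsP[q Hq]|/existsPn nq] := boolP [exists q : option ('I_a + 'I_b),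
      ~~ e0 (f (star_edge q).1) (f (star_edge q).2)].
    right; apply/bigcupP.
    exists (q, (f (star_edge q).1, f (star_edge q).2)); last by rewrite inE !eqxx.
    rewrite in_setX in_setT inE /= Hq andbT.
    by case: q {Hq} => [[i|j]|] /=; [exact: eu | exact: ev | ].
  left; apply/star_embeddingsP; split=> //.
  - by have := nq None; rewrite negbK.
  - by move=> i; have := nq (Some (inl i)); rewrite negbK.
  - by move=> i; have := nq (Some (inr i)); rewrite negbK.
apply: leq_trans (subset_leq_card sub) _.
apply: leq_trans (leq_card_setU _ _) _; rewrite leq_add2l.
have -> : (a + b).+1 * #|B| = #|setX [set: option ('I_a + 'I_b)] B|.
  by rewrite cardsX cardsT card_option card_sum !card_ord.
rewrite -sum_nat_const; apply: leq_trans (_ : \sum_(qp in setX setT B) #|X qp| <= _).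
  apply: (big_ind2 (fun (A : {set {ffun S -> T}}) n => #|A| <= n)) => //.
    by rewrite cards0.
  move=> A1 n1 A2 n2 H1 H2; apply: leq_trans (leq_card_setU _ _) _.
  exact: leq_add.
apply: leq_sum => -[q [x y]] _; apply: card_ffun_fix2.
by case: q => [[i|j]|].
Qed.

End StarCount.

Lemma star_count_mono a b (T T' : finType) (e : rel T) (e' : rel T') (h : T -> T') :
  injective h -> (forall x y, e x y -> e' (h x) (h y)) ->
  star_count a b e <= star_count a b e'.
Proof.
move=> inj_h eh.
pose c (f : {ffun option 'I_a + option 'I_b -> T}) :
  {ffun option 'I_a + option 'I_b -> T'} := [ffun s => h (f s)].
have inj_c : injective c.
  move=> f g /ffunP E; apply/ffunP => s; apply: inj_h.
  by have := E s; rewrite !ffunE.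
rewrite /star_count -(card_imset _ inj_c).
apply: subset_leq_card; apply/subsetP => _ /imsetP[f ef ->].
case/star_embeddingsP: ef => inj_f euv eu ev.
apply/star_embeddingsP; split => *; rewrite ?ffunE; try exact: eh.
by move=> s t; rewrite !ffunE => /inj_h/inj_f.
Qed.

Lemma num_copies_double_star_le a b (T T' : finType) (G : sgraph T) (G' : sgraph T') :
  star_count a b (adj G) <= star_count a b (adj G') ->
  num_copies (double_star a b) G <= num_copies (double_star a b) G'.
Proof.
rewrite /star_count -!embeddings_double_star !card_embeddings.
by rewrite leq_pmul2l // automorphisms_gt0.
Qed.

(** * The graphs [K_{s,t}^+] *)

Lemma adj_bipartite_plus s t (x y : 'I_s + 'I_t) :
  adj (bipartite_plus s t) x y =
  match x, y with
  | inl i, inl j => ((i == 0 :> nat) && (j == 1 :> nat))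
                 || ((j == 0 :> nat) && (i == 1 :> nat))
  | inr _, inr _ => false
  | _, _ => true
  end.
Proof.
rewrite adj_graph_of_rel; case: x y => [i|i] [j|j] //=; last by rewrite andbF.
apply: andb_idl => ij; apply: contraTneq ij => -[->].
by case: (val j) => [|[]].
Qed.

(** Apart from the edge between 0 and 1 the graph is bipartite, so every triangle uses that edge. *)
Lemma bipartite_plus_triangle s t (x y z : 'I_s + 'I_t) :
  adj (bipartite_plus s t) x y -> adj (bipartite_plus s t) x z ->
  adj (bipartite_plus s t) y z ->
  exists i j : 'I_s, [/\ i = 0 :> nat, j = 1 :> nat,
    inl i \in [:: x; y; z] & inl j \in [:: x; y; z]].
Proof.
rewrite !adj_bipartite_plus.
case: x y z => [i|i] [j|j] [k|k] //= H1 H2 H3.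
- by move: H1 H2 H3; case/orP=> /andP[/eqP-> /eqP->] //=; case: (val k) => [|[]].
- case/orP: H1 => /andP[/eqP H /eqP H']; [exists i, j|exists j, i];
    by rewrite H H' !inE !eqxx ?orbT.
- case/orP: H2 => /andP[/eqP H /eqP H']; [exists i, k|exists k, i];
    by rewrite H H' !inE !eqxx ?orbT.
- case/orP: H3 => /andP[/eqP H /eqP H']; [exists j, k|exists k, j];
    by rewrite H H' !inE !eqxx ?orbT.
Qed.

(** Both triangles would contain both ends of the extra edge, whereas the triangles of a 2-fan share
    one vertex only. *)
Lemma bipartite_plus_no_two_fan s t (z x y x' y' : 'I_s + 'I_t) :
  let e := adj (bipartite_plus s t) in uniq [:: z; x; y; x'; y'] ->
  e z x -> e z y -> e x y -> e z x' -> e z y' -> e x' y' -> False.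
Proof.
move=> e; rewrite /= !inE !negb_or.
case/and5P=> /and4P[zx zy zx' zy'] /and3P[xy xx' xy'] /andP[yx' yy'] x'y' _.
move=> ezx ezy exy ezx' ezy' ex'y'.
have [i [j [i0 j1 iT jT]]] := bipartite_plus_triangle ezx ezy exy.
have [i' [j' [i'0 j'1 i'T j'T]]] := bipartite_plus_triangle ezx' ezy' ex'y'.
have Ei : i' = i by apply: val_inj; rewrite /= i0 i'0.
have Ej : j' = j by apply: val_inj; rewrite /= j1 j'1.
rewrite Ei Ej in i'T j'T.
have key w : w \in [:: z; x; y] -> w \in [:: z; x'; y'] -> w = z.
  rewrite !inE => /or3P[] /eqP-> //; rewrite eq_sym.
    by rewrite (negPf zx) (negPf xx') (negPf xy').
  by rewrite (negPf zy) (negPf yx') (negPf yy').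
have := key _ jT j'T; rewrite -(key _ iT i'T) => -[E].
by rewrite E i0 in j1.
Qed.

Definition gsum (a b x y : nat) := phi a b x y + phi a b y x.

(** The first term comes from central edges between the parts, the second from the extra edge as
    central edge in both orientations. Embeddings that join a leaf along the extra edge are left
    out. *)
Lemma star_count_bipartite_plus_ge a b m l : 2 <= m ->
  m * l * gsum a b m l + 2 * l ^_ (a + b)
    <= star_count a b (adj (bipartite_plus m l)).
Proof.
move=> m2; set e := adj _.
have m0 : 0 < m by lia.
have fLR (i : 'I_m) (j : 'I_l) :
    phi a b l m <= #|star_fiber a b e (inl i) (inr j)|.
  rewrite /phi.
  have cA : #|[set (inr w : 'I_m + 'I_l)%type | w in [set~ j]]| = l.-1.
    by rewrite card_imset ?cardsC1 ?card_ord // => ? ? [].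
  have cB : #|[set (inl w : 'I_m + 'I_l)%type | w in [set~ i]]| = m.-1.
    by rewrite card_imset ?cardsC1 ?card_ord // => ? ? [].
  rewrite -{1}cA -{1}cB; apply: star_fiber_ge_disjoint; rewrite /e ?adj_bipartite_plus //.
  - apply/pred0P => w /=; apply/negP => /andP[/imsetP[? _ ->] /imsetP[]] //.
  - by apply/negP => /imsetP[k]; rewrite !inE => /eqP ki [] /esym.
  - by apply/negP => /imsetP[k]; rewrite !inE => /eqP ki [] /esym.
  - by move=> _ /imsetP[k _ ->]; rewrite adj_bipartite_plus.
  - by move=> _ /imsetP[k _ ->]; rewrite adj_bipartite_plus.
have fRL (i : 'I_m) (j : 'I_l) :
    phi a b m l <= #|star_fiber a b e (inr j) (inl i)|.
  rewrite /phi.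
  have cA : #|[set (inr w : 'I_m + 'I_l)%type | w in [set~ j]]| = l.-1.
    by rewrite card_imset ?cardsC1 ?card_ord // => ? ? [].
  have cB : #|[set (inl w : 'I_m + 'I_l)%type | w in [set~ i]]| = m.-1.
    by rewrite card_imset ?cardsC1 ?card_ord // => ? ? [].
  rewrite -{1}cA -{1}cB; apply: star_fiber_ge_disjoint; rewrite /e ?adj_bipartite_plus //.
  - apply/pred0P => w /=; apply/negP => /andP[/imsetP[? _ ->] /imsetP[]] //.
  - by apply/negP => /imsetP[k]; rewrite !inE => /eqP ki [] /esym.
  - by apply/negP => /imsetP[k]; rewrite !inE => /eqP ki [] /esym.
  - by move=> _ /imsetP[k _ ->]; rewrite adj_bipartite_plus.
  - by move=> _ /imsetP[k _ ->]; rewrite adj_bipartite_plus.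
have fLL (i j : 'I_m) : e (inl i) (inl j) ->
    l ^_ (a + b) <= #|star_fiber a b e (inl i) (inl j)|.
  move=> ij.
  have cA : #|[set (inr w : 'I_m + 'I_l)%type | w in [set: 'I_l]]| = l.
    by rewrite card_imset ?cardsT ?card_ord // => ? ? [].
  rewrite -{1}cA; apply: star_fiber_ge_common => //.
  - by apply: contraTneq ij => ->; rewrite /e adj_irr.
  - by apply/negP => /imsetP[].
  - by apply/negP => /imsetP[].
  - by move=> _ /imsetP[k _ ->]; rewrite /e !adj_bipartite_plus.
have LL : 2 * l ^_ (a + b)
    <= \sum_(i < m) \sum_(j < m) #|star_fiber a b e (inl i) (inl j)|.
  pose o0 := Ordinal m0; pose o1 : 'I_m := Ordinal m2.
  have h0 : l ^_ (a + b) <= #|star_fiber a b e (inl o0) (inl o1)|.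
    by apply: fLL; rewrite /e adj_bipartite_plus.
  have h1 : l ^_ (a + b) <= #|star_fiber a b e (inl o1) (inl o0)|.
    by apply: fLL; rewrite /e adj_bipartite_plus.
  rewrite (bigD1 o0) //= [X in _ <= _ + X](bigD1 o1) //= mul2n -addnn addnA.
  apply: leq_trans (leq_addr _ _); apply: leq_add.
    by rewrite (bigD1 o1) //=; apply: leq_trans h0 (leq_addr _ _).
  by rewrite (bigD1 o0) //=; apply: leq_trans h1 (leq_addr _ _).
have sumLR : m * l * phi a b l m
    <= \sum_(i < m) \sum_(j < l) #|star_fiber a b e (inl i) (inr j)|.
  apply: leq_trans (_ : \sum_(i < m) \sum_(j < l) phi a b l m <= _).
    by rewrite !sum_nat_const !card_ord mulnA.
  by apply: leq_sum => i _; apply: leq_sum => j _.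
have sumRL : m * l * phi a b m l
    <= \sum_(j < l) \sum_(i < m) #|star_fiber a b e (inr j) (inl i)|.
  apply: leq_trans (_ : \sum_(j < l) \sum_(i < m) phi a b m l <= _).
    by rewrite !sum_nat_const !card_ord mulnA (mulnC l).
  by apply: leq_sum => i _; apply: leq_sum => j _.
rewrite star_countE big_sumType /=.
under eq_bigr => i _ do rewrite big_sumType /=.
under [X in _ <= _ + X]eq_bigr => i _ do rewrite big_sumType /=.
rewrite !big_split /= /gsum mulnDr addnC (addnC (m * l * _)) !addnA.
by apply: leq_trans (leq_addr _ _); rewrite !leq_add.
Qed.

Lemma star_count_le_bipartite_plus a b (T : finType) (e : rel T)
    (P : {set T}) (x y : T) :
  x \in P -> y \in P -> x != y -> 0 < #|T| - #|P| ->
  (forall u v, u \in P -> v \in P -> e u v ->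
     (u = x /\ v = y) \/ (u = y /\ v = x)) ->
  (forall u v, u \notin P -> v \notin P -> ~~ e u v) ->
  star_count a b e <= star_count a b (adj (bipartite_plus #|P| (#|T| - #|P|))).
Proof.
move=> xP yP xy l0 eP eC.
(* Listing [x] and [y] first gives them the indices 0 and 1 of the extra edge. *)
pose s := [:: x, y & enum (P :\ x :\ y)].
have us : uniq s.
  by rewrite /= enum_uniq andbT !inE !mem_enum !inE !eqxx ?andbF /= orbF xy.
have ms u : (u \in s) = (u \in P).
  rewrite !inE mem_enum !inE.
  by case: eqVneq => [->|ux] //=; case: eqVneq => [->|uy].
have ss : size s = #|P|.
  by rewrite -(card_uniqP us); apply: eq_card => u; rewrite ms.
have m0 : 0 < #|P| by rewrite -ss.
pose q := enum (~: P).
have sq : size q = #|T| - #|P| by rewrite -cardE cardsCs setCK.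
(* The indices are always in range, so the defaults of [insubd] are never returned. *)
pose h (u : T) : ('I_#|P| + 'I_(#|T| - #|P|))%type :=
  if u \in P then inl (insubd (Ordinal m0) (index u s))
  else inr (insubd (Ordinal l0) (index u q)).
have hP u : u \in P -> exists2 i, h u = inl i & val i = index u s.
  move=> uP; rewrite /h uP; eexists; first by [].
  by rewrite val_insubd ifT // -ss index_mem ms.
have hC u : u \notin P -> exists2 i, h u = inr i & val i = index u q.
  move=> uP; rewrite /h (negPf uP); eexists; first by [].
  by rewrite val_insubd ifT // -sq index_mem mem_enum inE.
apply: (@star_count_mono a b T _ e _ h).
  move=> u v.
  have [uP|uP] := boolP (u \in P); have [vP|vP] := boolP (v \in P).
  - have [i -> iu] := hP _ uP; have [j -> jv] := hP _ vP => -[ij].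
    have := nth_index x (_ : u \in s); rewrite -iu ij jv nth_index ?ms // => -> //.
  - by have [i -> _] := hP _ uP; have [j -> _] := hC _ vP.
  - by have [i -> _] := hC _ uP; have [j -> _] := hP _ vP.
  - have [i -> iu] := hC _ uP; have [j -> jv] := hC _ vP => -[ij].
    have uq : u \in q by rewrite mem_enum inE.
    have vq : v \in q by rewrite mem_enum inE.
    by rewrite -(nth_index x uq) -iu ij jv nth_index.
have ix : index x s = 0 by rewrite /= eqxx.
have iy : index y s = 1 by rewrite /= (negPf xy) eqxx.
move=> u v euv; rewrite adj_bipartite_plus.
have [uP|uP] := boolP (u \in P); have [vP|vP] := boolP (v \in P).
- have [i -> iu] := hP _ uP; have [j -> jv] := hP _ vP.
  change ((val i == 0) && (val j == 1) || (val j == 0) && (val i == 1)).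
  by rewrite iu jv; case: (eP _ _ uP vP euv) => -[-> ->]; rewrite ix iy.
- by have [i -> _] := hP _ uP; have [j -> _] := hC _ vP.
- by have [i -> _] := hC _ uP; have [j -> _] := hP _ vP.
- by rewrite (negPf (eC _ _ uP vP)) in euv.
Qed.

(** * A matching meeting all triangles *)

Definition fan_free (T : finType) (e : rel T) :=
  forall z x y x' y', uniq [:: z; x; y; x'; y'] ->
  e z x -> e z y -> e x y -> e z x' -> e z y' -> e x' y' -> False.

Definition triangle_free (T : finType) (e : rel T) :=
  forall x y z, e x y -> e x z -> e y z -> False.

Section TriangleMatching.

Variables (T : finType) (e : rel T).
Hypotheses (e_sym : symmetric e) (e_irr : irreflexive e) (e_fan : fan_free e).

Definition hits_triangles (M : {set {set T}}) :=
  [forall x, forall y, forall z, e x y && e x z && e y z ==>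
    [|| [set x; y] \in M, [set x; z] \in M | [set y; z] \in M]].

Lemma hits_trianglesP (M : {set {set T}}) : reflect
  (forall x y z, e x y -> e x z -> e y z ->
    [|| [set x; y] \in M, [set x; z] \in M | [set y; z] \in M])
  (hits_triangles M).
Proof.
apply: (iffP forallP) => [H x y z exy exz eyz | H x].
  by have /forallP/(_ y)/forallP/(_ z)/implyP := H x; apply; rewrite exy exz.
apply/forallP => y; apply/forallP => z; apply/implyP => /andP[/andP[]].
exact: H.
Qed.

Lemma unhit_triangle (M M' : {set {set T}}) : hits_triangles M -> ~~ hits_triangles M' ->
  exists p q r, [/\ e p q, e p r, e q r & [/\ [set p; q] \in M,
    [set p; q] \notin M', [set p; r] \notin M' & [set q; r] \notin M']].
Proof.
move=> /hits_trianglesP hM /forallPn[x /forallPn[y /forallPn[z]]].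
rewrite negb_imply !negb_or => /andP[/andP[/andP[exy exz] eyz] /and3P[xy xz yz]].
case/or3P: (hM _ _ _ exy exz eyz) => hit.
- by exists x, y, z.
- by exists x, z, y; rewrite (e_sym z y) (setUC [set z]).
- by exists y, z, x; rewrite (e_sym y x) (e_sym z x) !(setUC _ [set x]).
Qed.

Lemma adj_neq x y : e x y -> x != y.
Proof. by apply: contraTneq => ->; rewrite e_irr. Qed.

(** [M] is a hitting set of minimum size. Minimality gives each of its edges a private triangle, hit
    by no other element of [M], and two edges of [M] at a common vertex could be exchanged for a
    single one. *)
Lemma triangle_matching : exists M : {set {set T}},
  [/\ forall x y z, e x y -> e x z -> e y z ->
        [|| [set x; y] \in M, [set x; z] \in M | [set y; z] \in M],
      forall x y, e x y -> [set x; y] \in M ->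
        exists z, [/\ e x z, e y z, [set x; z] \notin M & [set y; z] \notin M]
    & forall x y y', e x y -> e x y' ->
        [set x; y] \in M -> [set x; y'] \in M -> y = y'].
Proof.
have hT : hits_triangles setT by apply/hits_trianglesP => *; rewrite inE.
pose M := [arg min_(M < setT | hits_triangles M) #|M|].
have {hT} [hM minM] : hits_triangles M /\ forall M', hits_triangles M' -> #|M| <= #|M'|.
  by rewrite /M; case: arg_minnP.
move: M hM minM => M hM minM.
have priv x y : e x y -> [set x; y] \in M ->
    exists z, [/\ e x z, e y z, [set x; z] \notin M & [set y; z] \notin M].
  move=> exy xyM.
  have : ~~ hits_triangles (M :\ [set x; y]).
    by apply/negP => /minM; rewrite (cardsD1 [set x; y] M) xyM add1n ltnn.
  case/(unhit_triangle hM) => p [q [r [epq epr eqr [pqM]]]].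
  rewrite in_setD1 pqM andbT negbK => /eqP pq.
  have np w : e w r -> w \in [set x; y] -> [set w; r] \notin M :\ [set x; y] ->
      [set w; r] \notin M.
    move=> ewr wxy; rewrite in_setD1; apply: contra => wrM; rewrite wrM andbT.
    apply/eqP => E; have := set22 w r; rewrite E -pq => /set2P[] rE.
      by rewrite rE e_irr in epr.
    by rewrite rE e_irr in eqr.
  case: (set2_eq pq) => -[-> ->] in epr eqr * => h1 h2; exists r; split=> //.
  - by apply: np; rewrite ?set21.
  - by apply: np; rewrite ?set22.
  - by apply: np; rewrite ?set21.
  - by apply: np; rewrite ?set22.
exists M; split=> //; first exact/hits_trianglesP.
move=> x y y' exy exy' xyM xy'M; apply/eqP; apply: contraT => yy'.
have [z [exz eyz xzM yzM]] := priv _ _ exy xyM.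
have [z' [exz' ey'z' xz'M y'z'M]] := priv _ _ exy' xy'M.
have yz' : y != z' by apply: contraNneq xz'M => <-.
have zy' : z != y' by apply: contraNneq xzM => ->.
(* Otherwise the two private triangles form a 2-fan centred at [x]. *)
have ezz' : z = z'.
  apply/eqP; apply: contraT => zz'; exfalso.
  apply: (e_fan _ exy exz eyz exy' exz' ey'z').
  rewrite /= !inE !negb_or yy' yz' zy' zz' !(adj_neq exy, adj_neq exz, adj_neq exy',
    adj_neq exz', adj_neq eyz, adj_neq ey'z') //.
move: exz' ey'z' xz'M y'z'M; rewrite -ezz' => _ ey'z _ y'zM.
(* The exchange: [M'] is smaller than [M], so it misses a triangle, and that triangle contains [xy]
   or [xy']. *)
pose M' := [set x; z] |: M :\ [set x; y] :\ [set x; y'].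
have nxy : [set x; y'] != [set x; y].
  apply/eqP => /set2_eq[[_ E]|[E _]]; first by rewrite E eqxx in yy'.
  by rewrite E e_irr in exy.
have : ~~ hits_triangles M'.
  apply/negP => /minM; rewrite (cardsD1 [set x; y] M) xyM.
  rewrite (cardsD1 [set x; y'] (M :\ _)) in_setD1 nxy xy'M.
  have := leq_card_setU [set [set x; z]] (M :\ [set x; y] :\ [set x; y']).
  rewrite -/M' cards1 /= !add1n => le1 le2.
  by have := leq_trans le2 le1; rewrite ltnn.
case/(unhit_triangle hM) => p [q [r [epq epr eqr [pqM pqM' prM' qrM']]]].
have pq : [set p; q] = [set x; y] \/ [set p; q] = [set x; y'].
  have := pqM'; rewrite !inE pqM andbT !negb_or negb_and !negbK.
  by case/andP=> _ /orP[] /eqP; auto.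
(* A triangle on an edge [xu] missed by [M'] forces a [K_4] with a triangle
   missed by [M]. *)
have key u v w : e x u -> e x v -> u != v -> e u z -> e v z ->
    [set u; z] \notin M -> [set v; z] \notin M -> e x w -> e u w ->
    [set x; w] \notin M' -> [set u; w] \notin M' -> False.
  move=> exu exv uv euz evz uzM vzM exw euw xwM' uwM'.
  have wz : w != z by apply: contraNneq xwM' => ->; rewrite setU11.
  have [wv|wv] := eqVneq w v; last first.
    apply: (e_fan _ exu exw euw exv exz evz).
    by rewrite /= !inE !negb_or uv wv wz !adj_neq.
  have uvM : [set u; v] \notin M.
    apply: contra uwM'; rewrite wv /M' => uvM.
    have nx k : [set u; v] != [set x; k].
      apply/eqP => E; have := set21 x k; rewrite -E => /set2P[] E'.
        by rewrite E' e_irr in exu.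
      by rewrite E' e_irr in exv.
    by rewrite in_setU !in_setD1 !nx uvM orbT.
  move/hits_trianglesP: hM => /(_ u v z).
  by rewrite -{1}wv euw euz evz (negPf uvM) (negPf uzM) (negPf vzM) => /(_ isT isT isT).
exfalso; case: pq => /set2_eq[[E1 E2]|[E1 E2]]; subst p q.
- exact: (key y y' r).
- by apply: (key y y' r).
- by apply: (key y' y r); rewrite // eq_sym.
- by apply: (key y' y r); rewrite // eq_sym.
Qed.

End TriangleMatching.

(** * The triangle-free bound *)

Lemma leq_ffact m n k : m <= n -> m ^_ k <= n ^_ k.
Proof.
elim: k m n => [|k IH] m n mn; first by rewrite !ffactn0.
by rewrite !ffactnS leq_mul // IH //; lia.
Qed.

Lemma leq_gsum a b x y x' y' : x <= x' -> y <= y' -> gsum a b x y <= gsum a b x' y'.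
Proof.
by move=> xx yy; rewrite leq_add // leq_mul // leq_ffact //; lia.
Qed.

Lemma gsumC a b x y : gsum a b x y = gsum a b y x.
Proof. by rewrite /gsum addnC. Qed.

(* Contribution of a vertex of [R] with [s] neighbours in [I] and [q] in [R],
   each of whose edges carries at most [G] embeddings; edges inside [R] are
   seen from both ends. *)
Lemma deficit_small n D s q G O : s + q <= D -> D <= n -> D * (n - D) * G <= O ->
  3 * n * (n - D) * ((2 * s + q) * G) + 2 * (D - s) * O <= 6 * n * O.
Proof.
move=> sqD Dn GO.
have [D0|D0] := posnP D.
  have [-> ->] : s = 0 /\ q = 0 by lia.
  by rewrite D0 !(muln0, mul0n).
(* Multiplying the goal by [D] allows [D * (n - D) * G] to be replaced by [O]; this is what remains
   once [O] is cancelled. *)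
have key : 3 * n * (2 * s + q) + 2 * D * (D - s) <= 6 * n * D.
  have [k Dk] : exists k, D = s + k by exists (D - s); lia.
  have -> : D - s = k by lia.
  have h1 : 3 * n * (2 * s + q) <= 3 * n * (s + D) by rewrite leq_mul2l; lia.
  have h2 : 2 * D * k <= 3 * n * k by rewrite leq_mul2r; lia.
  apply: leq_trans (leq_add h1 h2) _.
  by rewrite Dk; apply: eq_leq; lia.
rewrite -(leq_pmul2l D0).
apply: leq_trans (_ : (3 * n * (2 * s + q) + 2 * D * (D - s)) * O <= _).
  rewrite [leqLHS]mulnDr [leqRHS]mulnDl; apply: leq_add; last by lia.
  apply: leq_trans (_ : 3 * n * (2 * s + q) * (D * (n - D) * G) <= _); first by lia.
  by rewrite leq_mul2l GO orbT.
apply: leq_trans (leq_mul key (leqnn O)) _; lia.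
Qed.

(** Used for vertices of degree [s + q] above [n - D]: their neighbours have degree at most
    [n - (s + q)], so the comparison is with the complete bipartite graph with parts [s + q] and
    [n - (s + q)]. *)
Lemma deficit_large n D s q G O : s + q <= D -> D < n ->
  (s + q) * (n - (s + q)) * G <= O ->
  3 * n * (n - D) * ((2 * s + q) * G) + 2 * (D - s) * O <= 6 * n * O.
Proof.
move=> sqD Dn GO.
have [d0|d0] := posnP (s + q).
  have -> : s = 0 by lia.
  have -> : q = 0 by lia.
  by rewrite mul0n muln0 add0n subn0 leq_mul2r; lia.
have [t nt] : exists t, n = s + q + t by exists (n - (s + q)); lia.
have t0 : 0 < t by lia.
have [w tw] : exists w, t = (n - D) + w by exists (D - (s + q)); lia.
have Dw : D - s = w + q by lia.
have nd : n - (s + q) = t by lia.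
set z := n - D in tw *; rewrite Dw; rewrite nd in GO.
have key : 3 * n * z * (2 * s + q) + 2 * (w + q) * ((s + q) * t)
    <= 6 * n * ((s + q) * t).
  have h1 : w * (s + q) * t <= w * (s + q) * n by rewrite leq_mul2l; lia.
  have h2 : q * (s + q) * t <= q * n * t by rewrite leq_mul // leq_mul //; lia.
  apply: leq_trans (_ : 3 * n * z * (2 * s + q) + 2 * (w * (s + q) * n)
      + 2 * (q * n * t) <= _).
    by rewrite -addnA leq_add2l; clear -h1 h2; lia.
  apply: leq_trans (leq_addr (n * q * z + 4 * (n * s * w) + 2 * (n * q * w)) _) _.
  by clear -tw; subst t; apply: eq_leq; lia.
have p0 : 0 < (s + q) * t by rewrite muln_gt0 d0.
rewrite -(leq_pmul2l p0).
apply: leq_trans (_ : (3 * n * z * (2 * s + q) + 2 * (w + q) * ((s + q) * t)) * O <= _).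
  rewrite [leqLHS]mulnDr [leqRHS]mulnDl; apply: leq_add; last by lia.
  apply: leq_trans (_ : 3 * n * z * (2 * s + q) * ((s + q) * t * G) <= _); first by lia.
  by rewrite leq_mul2l GO orbT.
apply: leq_trans (leq_mul key (leqnn O)) _; lia.
Qed.

Lemma leq_expl x y k : x <= y -> x ^ k <= y ^ k.
Proof. by case: k => // k xy; rewrite leq_exp2r. Qed.

Lemma ffact_le_exp n k : n ^_ k <= n ^ k.
Proof.
elim: k n => [|k IH] n; first by rewrite ffactn0.
rewrite ffactnS expnS leq_mul2l; apply/orP; right.
by apply: leq_trans (IH _) _; apply: leq_expl; lia.
Qed.

Lemma phi_le_exp a b x y n : x <= n -> y <= n -> phi a b x y <= n ^ (a + b).
Proof.
move=> xn yn; rewrite expnD leq_mul //.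
  by apply: leq_trans (ffact_le_exp _ _) _; apply: leq_expl; lia.
by apply: leq_trans (ffact_le_exp _ _) _; apply: leq_expl; lia.
Qed.

Definition missing (T : finType) (e : rel T) (A : {set T}) r :=
  #|[set u in A | ~~ e r u]|.

Section MaxDegree.

Variables (a b : nat) (T : finType) (e : rel T) (v0 : T).
Hypotheses (e_sym : symmetric e) (e_tf : triangle_free e).
Hypothesis v0_max : forall u, deg e u <= deg e v0.

Local Notation n := #|T|.
Local Notation D := (deg e v0).
Local Notation I := [set w | e v0 w].

Lemma nbr_indep u w : u \in I -> w \in I -> e u w = false.
Proof.
by rewrite !inE => v0u v0w; apply/negP => uw; apply: (e_tf v0u v0w).
Qed.

(** Without triangles, the neighbourhoods of adjacent vertices are disjoint. *)
Lemma deg_add u v : e u v -> deg e u + deg e v <= n.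
Proof.
move=> euv; rewrite /deg -cardsUI.
have -> : [set w | e u w] :&: [set w | e v w] = set0.
  apply/setP => w; rewrite !inE; apply/negP => /andP[uw vw].
  exact: (e_tf euv uw vw).
by rewrite cards0 addn0 max_card.
Qed.

Lemma deg_split r : #|[set v in I | e r v]| + #|[set v in ~: I | e r v]| = deg e r.
Proof.
rewrite /deg -(cardsID I [set w | e r w]); congr (_ + _); apply: eq_card => w.
  by rewrite !inE andbC.
by rewrite !inE.
Qed.

Lemma missing_nbr r : #|[set v in I | e r v]| + missing e I r = D.
Proof.
rewrite /missing [D]/deg -(cardsID [set v | e r v] I); congr (_ + _); apply: eq_card => w.
  by rewrite !inE.
by rewrite !inE andbC.
Qed.

Lemma card_nonnbr : #|~: I| = n - D.
Proof. by rewrite cardsCs setCK. Qed.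

Let F u v := if e u v then gsum a b (deg e u) (deg e v) else 0.

(** Since [I] is independent, every edge has an end outside it. In the doubled count an edge meeting
    [I] is charged twice to its other end, and an edge avoiding [I] once to each end. *)
Lemma star_count_le_sum_nonnbr : 2 * star_count a b e
  <= \sum_(r in ~: I) (2 * (\sum_(v in I) F r v) + \sum_(v in ~: I) F r v).
Proof.
have FC u v : F u v = F v u by rewrite /F e_sym gsumC.
(* [F] symmetrises [phi], so this sum is the bound of [star_count_le] plus the same bound with [u]
   and [v] exchanged. *)
apply: leq_trans (_ : \sum_u \sum_v F u v <= _).
  rewrite mul2n -addnn.
  apply: leq_trans (leq_add (star_count_le _ _ e_sym) (star_count_le _ _ e_sym)) _.
  rewrite [X in _ + X](exchange_big_dep predT) //= -big_split /=.
  apply: leq_sum => u _; rewrite [X in _ + X](eq_bigl (e u)); last first.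
    by move=> v; rewrite e_sym.
  by rewrite -big_split [leqLHS]big_mkcond /=.
rewrite (bigID (mem I)) /= addnC.
under eq_bigr => u _ do rewrite (bigID (mem I)) /=.
under [X in _ + X <= _]eq_bigr => u _ do rewrite (bigID (mem I)) /=.
rewrite [X in _ + X <= _]big_split /= [X in _ + (X + _) <= _]big1 ?add0n; last first.
  by move=> u uI; apply: big1 => v vI; rewrite /F nbr_indep.
rewrite [X in _ + X <= _](exchange_big_dep (fun r => r \notin I)) //= -big_split /=.
rewrite [leqRHS](eq_bigl (fun r => r \notin I)); last by move=> r; rewrite in_setC.
apply: leq_sum => r rI; rewrite mul2n -addnn.
have -> : \sum_(v in ~: I) F r v = \sum_(v | v \notin I) F r v.
  by apply: eq_bigl => v; rewrite in_setC.
under [X in _ + X <= _]eq_bigr => u _ do rewrite FC.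
rewrite addnAC leq_add2r leq_add2l (eq_bigl (mem I)) // => u.
by rewrite rI andbT.
Qed.

(** The inequality is proved at each of the [n - D] vertices outside [I], where every missing
    neighbour in [I] lowers the contribution, and is then summed. *)
Lemma star_count_deficit O :
  (forall x, x <= n -> x * (n - x) * gsum a b x (n - x) <= O) ->
  3 * n * (n - D) * star_count a b e + (\sum_(r in ~: I) missing e I r) * O
    <= 3 * n * (n - D) * O.
Proof.
move=> HO.
have Dn : D <= n by exact: max_card.
have [D_eq|Dlt] : D = n \/ D < n by lia.
  have I0 : ~: I = set0 by apply/eqP; rewrite -cards_eq0 card_nonnbr D_eq subnn.
  by rewrite I0 big_set0 D_eq subnn !muln0.
rewrite -(leq_pmul2l (isT : 0 < 2)).
have vertex r : r \in ~: I ->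
    3 * n * (n - D) * (2 * (\sum_(v in I) F r v) + \sum_(v in ~: I) F r v)
      + 2 * missing e I r * O <= 6 * n * O.
  move=> rI.
  set s := #|[set v in I | e r v]|; set q := #|[set v in ~: I | e r v]|.
  have sq : s + q = deg e r by exact: deg_split.
  have sm : s + missing e I r = D by exact: missing_nbr.
  have -> : missing e I r = D - s by lia.
  have bound G : (forall v, e r v -> gsum a b (deg e r) (deg e v) <= G) ->
      2 * (\sum_(v in I) F r v) + \sum_(v in ~: I) F r v <= (2 * s + q) * G.
    move=> HG.
    have part (A : {set T}) : \sum_(v in A) F r v <= #|[set v in A | e r v]| * G.
      rewrite -sum_nat_const big_mkcond [leqRHS]big_mkcond; apply: leq_sum => v _.
      by rewrite inE /F; case: (v \in A) => //=; case: ifP => // /HG.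
    by rewrite mulnDl -mulnA leq_add // ?part // leq_mul2l part.
  have Dr := v0_max r.
  (* Up to degree [n - D] the neighbours are bounded by the maximum degree [D]; beyond it [deg_add]
     gives the better bound [n - deg e r]. *)
  have [small|large] := leqP (deg e r) (n - D).
    apply: leq_trans (_ : 3 * n * (n - D) * ((2 * s + q) * gsum a b (n - D) D)
      + 2 * (D - s) * O <= _).
      rewrite leq_add2r leq_mul2l bound ?orbT // => v _.
      by apply: leq_gsum.
    apply: deficit_small; rewrite ?sq // gsumC; exact: HO.
  apply: leq_trans (_ : 3 * n * (n - D) * ((2 * s + q) * gsum a b (deg e r) (n - deg e r))
    + 2 * (D - s) * O <= _).
    rewrite leq_add2r leq_mul2l bound ?orbT // => v erv.
    by apply: leq_gsum => //; have := deg_add erv; lia.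
  apply: deficit_large; rewrite ?sq //.
  by apply: HO; apply: max_card.
have : \sum_(r in ~: I) (3 * n * (n - D)
      * (2 * (\sum_(v in I) F r v) + \sum_(v in ~: I) F r v)
      + 2 * missing e I r * O) <= \sum_(r in ~: I) 6 * n * O by exact: leq_sum.
rewrite big_split /= -big_distrr -big_distrl -big_distrr sum_nat_const card_nonnbr /= => total.
apply: leq_trans (_ : (n - D) * (6 * n * O) <= _); last first.
  have alg z N X : z * (6 * N * X) = 2 * (3 * N * z * X) by lia.
  by rewrite alg.
apply: leq_trans total; rewrite mulnDr mulnA; apply: leq_add; last by lia.
rewrite (mulnC 2) -mulnA leq_mul2l; apply/orP; right.
exact: star_count_le_sum_nonnbr.
Qed.

(** A crude bound for unbalanced graphs: there are at most [n * D] ordered adjacent pairs, and also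
    at most [2 * n * (n - D)], as every edge has an end outside [I]. *)
Lemma star_count_le_min :
  star_count a b e <= 2 * n * minn D (n - D) * n ^ (a + b).
Proof.
have degn u : deg e u <= n by exact: max_card.
have phin u v : phi a b (deg e u) (deg e v) <= n ^ (a + b) by exact: phi_le_exp.
case: (leqP D (n - D)) => _.
  apply: leq_trans (star_count_le _ _ e_sym) _.
  apply: leq_trans (_ : \sum_(u : T) D * n ^ (a + b) <= _); last first.
    by rewrite sum_nat_const mulnA leq_mul2r -mulnA mul2n -addnn leq_addr orbT.
  apply: leq_sum => u _.
  apply: leq_trans (_ : \sum_(v | e u v) n ^ (a + b) <= _); first exact: leq_sum.
  rewrite sum_nat_const leq_mul2r; apply/orP; right.
  by apply: leq_trans (v0_max u); rewrite /deg cardsE.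
rewrite -(leq_pmul2l (isT : 0 < 2)).
apply: leq_trans star_count_le_sum_nonnbr _.
have FK u v : F u v <= 2 * n ^ (a + b).
  by rewrite /F; case: ifP => // _; rewrite mul2n -addnn leq_add.
apply: leq_trans (_ : \sum_(r in ~: I) 2 * (n * (2 * n ^ (a + b))) <= _); last first.
  rewrite sum_nat_const card_nonnbr.
  have alg z N X : z * (2 * (N * (2 * X))) = 2 * (2 * N * z * X) by lia.
  by rewrite alg.
apply: leq_sum => r _.
apply: leq_trans (_ : 2 * (\sum_(v in I) F r v + \sum_(v in ~: I) F r v) <= _).
  by rewrite mulnDr leq_add2l leq_pmull.
rewrite leq_mul2l /=.
have -> : \sum_(v in I) F r v + \sum_(v in ~: I) F r v = \sum_v F r v.
  rewrite [RHS](bigID (mem I)) /=; congr (_ + _).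
  by apply: eq_bigl => v; rewrite in_setC.
by rewrite -sum_nat_const; apply: leq_sum.
Qed.

End MaxDegree.

(** * Missing edges forced by the matching *)

Section Structure.

Variables (T : finType) (e : rel T) (M : {set {set T}}) (v0 : T).
Hypotheses (e_sym : symmetric e) (e_irr : irreflexive e) (e_fan : fan_free e).
Hypothesis M_hits : forall x y z, e x y -> e x z -> e y z ->
  [|| [set x; y] \in M, [set x; z] \in M | [set y; z] \in M].
Hypothesis M_private : forall x y, e x y -> [set x; y] \in M ->
  exists z, [/\ e x z, e y z, [set x; z] \notin M & [set y; z] \notin M].
Hypothesis M_matching : forall x y y', e x y -> e x y' ->
  [set x; y] \in M -> [set x; y'] \in M -> y = y'.

Definition rest : rel T := fun x y => e x y && ([set x; y] \notin M).
(** [M] is only a set of vertex sets and may contain non-edges, hence the conjunct [e x y]. *)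
Definition mate : rel T := fun x y => e x y && ([set x; y] \in M).

Lemma rest_sym : symmetric rest.
Proof. by move=> x y; rewrite /rest e_sym setUC. Qed.

Lemma mate_sym : symmetric mate.
Proof. by move=> x y; rewrite /mate e_sym setUC. Qed.

Lemma rest_tf : triangle_free rest.
Proof.
move=> x y z /andP[xy nxy] /andP[xz nxz] /andP[yz nyz].
by have := M_hits xy xz yz; rewrite (negPf nxy) (negPf nxz) (negPf nyz).
Qed.

Lemma rest_or_mate x y : e x y = rest x y || mate x y.
Proof. by rewrite /rest /mate -andb_orr orNb andbT. Qed.

Lemma mate_uniq x y y' : mate x y -> mate x y' -> y = y'.
Proof. by move=> /andP[? ?] /andP[? ?]; apply: (@M_matching x). Qed.

Lemma mate_neq x y : mate x y -> x != y.
Proof. by case/andP => + _; apply: contraTneq => ->; rewrite e_irr. Qed.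

(** The cardinality is twice the number of matching edges inside [A]. *)
Definition matched (A : {set T}) := [set x in A | [exists y in A, mate x y]].

Lemma mates_two_fan r x y x' y' : mate x y -> mate x' y' ->
  r \notin [:: x; y; x'; y'] -> x' != x -> x' != y ->
  e r x -> e r y -> e r x' -> e r y' -> False.
Proof.
move=> mxy mxy' rN x'x x'y erx ery erx' ery'.
case/andP: (mxy) (mxy') => exy _ /andP[exy' _].
apply: (e_fan _ erx ery exy erx' ery' exy').
rewrite cons_uniq rN /= !inE !negb_or (mate_neq mxy) (mate_neq mxy').
rewrite (eq_sym x) x'x (eq_sym y) x'y !andbT /=; apply/andP; split.
  by apply: contraNneq x'y => xy'; apply/eqP/(mate_uniq _ mxy); rewrite mate_sym xy'.
apply: contraNneq x'x => yy'; apply/eqP; apply: (@mate_uniq y); rewrite mate_sym //.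
by rewrite yy'.
Qed.

(** At most one matching edge inside [A] has both ends adjacent to [r], by fan-freeness; this is the
    2. All other matched vertices are non-neighbours of [r] or mates of such. *)
Lemma card_matched_le (A : {set T}) r : r \notin A ->
  #|matched A| <= 2 + 2 * missing rest A r.
Proof.
move=> rA; rewrite /missing; set N := [set u in A | ~~ rest r u].
pose N' := [set u | [exists w in N, mate w u]].
have cN' : #|N'| <= #|N|.
  (* The default is never taken on [N'], where a mate in [N] exists. *)
  pose h u := odflt u [pick w in N | mate w u].
  have hP u : u \in N' -> h u \in N /\ mate (h u) u.
    rewrite inE /h => /existsP[w wu]; case: pickP => [w' /andP[]//|/(_ w)].
    by rewrite wu.
  have inj_h : {in N' &, injective h}.
    move=> u u' /hP[_ hu] /hP[_ hu'] E; apply: (mate_uniq hu).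
    by rewrite E.
  rewrite -(card_in_imset inj_h); apply: subset_leq_card.
  by apply/subsetP => _ /imsetP[u /hP[uN _] ->].
have CP x : x \in matched A :\: (N :|: N') ->
    exists y, [/\ x \in A, y \in A, mate x y, rest r x & rest r y].
  rewrite in_setD in_setU negb_or => /andP[/andP[xN xN']].
  rewrite inE => /andP[xA /exists_inP[y yA xy]]; exists y; split=> //.
    by apply: contraNT xN => rx; rewrite inE xA.
  apply: contraNT xN' => ry; rewrite inE; apply/exists_inP; exists y.
    by rewrite inE yA.
  by rewrite mate_sym.
have cC : #|matched A :\: (N :|: N')| <= 2.
  have [->|/set0Pn[x xC]] := eqVneq (matched A :\: (N :|: N')) set0.
    by rewrite cards0.
  have [y [xA yA xy /andP[rx _] /andP[ry _]]] := CP _ xC.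
  apply: leq_trans (_ : #|[set x; y]| <= 2); last by rewrite cards2; case: eqP.
  apply: subset_leq_card; apply/subsetP => x' x'C; rewrite !inE.
  apply: contraT; rewrite negb_or => /andP[x'x x'y].
  have [y' [x'A y'A xy' /andP[rx' _] /andP[ry' _]]] := CP _ x'C.
  exfalso; apply: (mates_two_fan xy xy' _ x'x x'y rx ry rx' ry').
  by apply: contra rA; rewrite !inE => /or4P[] /eqP->.
have sub : matched A \subset (matched A :\: (N :|: N')) :|: (N :|: N').
  by apply/subsetP => x xm; rewrite !in_setU in_setD in_setU xm andbT orNb.
have le1 := subset_leq_card sub.
have le2 := leq_card_setU (matched A :\: (N :|: N')) (N :|: N').
have le3 := leq_card_setU N N'.
apply: leq_trans le1 (leq_trans le2 _); apply: leq_add cC _.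
by apply: leq_trans le3 _; rewrite mul2n -addnn leq_add2l.
Qed.

Local Notation n := #|T|.
Local Notation D := (deg rest v0).
Local Notation I := [set w | rest v0 w].
Local Notation p := (\sum_(r in ~: I) missing rest I r).

Lemma rest_nbr x y : x \in I -> y \in I -> rest x y = false.
Proof. exact: nbr_indep rest_tf _ _. Qed.

(** Double counting of the non-adjacent pairs between [I] and its complement. *)
Lemma sum_missing_nbr : \sum_(u in I) missing rest (~: I) u = p.
Proof.
rewrite /missing.
under eq_bigr => u _ do rewrite -sum1dep_card.
under [RHS]eq_bigr => u _ do rewrite -sum1dep_card.
rewrite (exchange_big_dep (fun r => r \in ~: I)) /=; last by move=> u r _ /andP[].
apply: eq_bigr => r rI; apply: eq_bigl => u.
by rewrite rI /= rest_sym.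
Qed.

Lemma matched_nbr_le : (n - D) * #|matched I| <= 2 * (n - D) + 2 * p.
Proof.
rewrite -card_nonnbr -sum_nat_const (mulnC 2 #|_|) -sum_nat_const big_distrr -big_split /=.
by apply: leq_sum => r; rewrite in_setC => /card_matched_le.
Qed.

Lemma matched_nonnbr_le : D * #|matched (~: I)| <= 2 * D + 2 * p.
Proof.
rewrite -sum_missing_nbr.
rewrite /deg -sum_nat_const (mulnC 2 #|_|) -sum_nat_const big_distrr -big_split /=.
by apply: leq_sum => r rI; apply: card_matched_le; rewrite in_setC rI.
Qed.

(** Adjacent vertices have no common neighbour in [rest], so each vertex of [I] is missed by one of
    them. *)
Lemma rest_missing r r' : rest r r' -> D <= missing rest I r + missing rest I r'.
Proof.
move=> rr'; rewrite /missing.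
apply: leq_trans (leq_card_setU _ _); apply: subset_leq_card.
apply/subsetP => u; rewrite !inE => ->.
rewrite /= -negb_and; apply/negP => /andP[ru r'u].
exact: (rest_tf rr' ru r'u).
Qed.

Lemma rest_nonnbr_le r r' : r \notin I -> r' \notin I -> rest r r' -> D <= p.
Proof.
move=> rI r'I rr'; apply: leq_trans (rest_missing rr') _.
have r'r : r' != r.
  by apply: contraTneq rr' => ->; rewrite /rest e_irr.
rewrite (bigD1 r) ?in_setC //= (bigD1 r') ?in_setC ?r'I //=.
by rewrite addnA leq_addr.
Qed.

Definition crossing := [set y in ~: I | [exists x in I, mate y x]].

Lemma in_crossing y :
  (y \in crossing) = (y \notin I) && [exists x in I, mate y x].
Proof. by rewrite /crossing in_set in_setC. Qed.

(** The third vertex [h y] of the private triangle on a crossing edge [yx] lies outside [I], as [I]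
    is independent in [rest]. Thus [rest] joins [y] to [h y], which costs [D] missing pairs. As [h]
    is injective, no vertex is charged more than twice. *)
Lemma crossing_le : D * #|crossing| <= 2 * p.
Proof.
pose Q y z := [exists x in I, [&& mate y x, e x z, e y z, z \notin I & rest y z]].
pose h y := odflt y [pick z | Q y z].
have hP y : y \in crossing -> exists2 x, x \in I &
    [/\ mate y x, e x (h y), e y (h y), h y \notin I & rest y (h y)].
  rewrite in_crossing => /andP[yI /exists_inP[x xI yx]].
  rewrite /h; case: pickP => /= [z /exists_inP[x' ? /and5P[*]]|noz]; first by exists x'.
  exfalso.
  have [z [eyz exz yzM xzM]] : exists z,
      [/\ e y z, e x z, [set y; z] \notin M & [set x; z] \notin M].
    by case/andP: yx => ? ?; apply: M_private.
  suff : Q y z by rewrite noz.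
  apply/exists_inP; exists x => //.
  rewrite yx exz eyz /rest eyz yzM !andbT /=; apply/negP => zI.
  by have := rest_nbr xI zI; rewrite /rest exz xzM.
(* Two crossing edges with the same third vertex would give a 2-fan centred there. *)
have inj_h : {in crossing &, injective h}.
  move=> y y' yc y'c E; apply/eqP; apply: contraT => yy'; exfalso.
  have [x xI [yx exz eyz zI _]] := hP _ yc.
  have [x' x'I [yx' ex'z ey'z _ _]] := hP _ y'c.
  rewrite -E in ex'z ey'z.
  have yI : y \notin I by move: yc; rewrite in_crossing => /andP[].
  have y'I : y' \notin I by move: y'c; rewrite in_crossing => /andP[].
  have neq w w' : w \in I -> w' \notin I -> w' != w.
    by move=> wI; apply: contraNneq => ->.
  have nez w : e w (h y) -> h y != w by apply: contraTneq => ->; rewrite e_irr.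
  apply: (mates_two_fan (r := h y) yx yx'); rewrite 1?e_sym //.
  - by rewrite !inE !negb_or !nez.
  - by rewrite eq_sym.
  - exact: neq.
rewrite mulnC -sum_nat_const.
apply: leq_trans (_ : \sum_(y in crossing)
    (missing rest I y + missing rest I (h y)) <= _).
  apply: leq_sum => y /hP[x _ [_ _ _ _]]; exact: rest_missing.
rewrite big_split mul2n -addnn; apply: leq_add.
  rewrite big_mkcond [leqRHS]big_mkcond; apply: leq_sum => y _.
  by case: ifP => //; rewrite in_crossing in_setC => /andP[-> _].
rewrite -(big_imset (missing rest I) inj_h) /=.
rewrite big_mkcond [leqRHS]big_mkcond; apply: leq_sum => z _.
case: ifP => // /imsetP[y /hP[x _ [_ _ _ zI _]] ->].
by rewrite in_setC zI.
Qed.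

(** Ordered pairs, in the form in which [star_count_perturb] counts them. *)
Definition mates := [set xy | e xy.1 xy.2 & ~~ rest xy.1 xy.2].

Lemma card_mates_le :
  #|mates| <= #|matched I| + #|matched (~: I)| + 2 * #|crossing|.
Proof.
have mP xy : xy \in mates -> mate xy.1 xy.2.
  by rewrite inE rest_or_mate => /andP[/orP[->|]].
have m1 (A B : {set T}) (C : {set T}) :
    (forall x y, x \in A -> y \in B -> mate x y -> x \in C) ->
    #|[set xy in mates | (xy.1 \in A) && (xy.2 \in B)]| <= #|C|.
  move=> sub; rewrite -(@card_in_imset _ _ fst); last first.
    move=> [x y] [x' y'] /=; rewrite inE => /andP[/mP /= m _].
    rewrite inE => /andP[/mP /= m' _] E; rewrite -E in m' *.
    by rewrite (mate_uniq m m').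
  apply: subset_leq_card; apply/subsetP => _ /imsetP[[x y] xy ->] /=.
  by move: xy; rewrite inE => /andP[/mP /= m /andP[/= xA yB]]; apply: sub m.
have m2 (A B : {set T}) (C : {set T}) :
    (forall x y, x \in A -> y \in B -> mate x y -> y \in C) ->
    #|[set xy in mates | (xy.1 \in A) && (xy.2 \in B)]| <= #|C|.
  move=> sub; rewrite -(@card_in_imset _ _ snd); last first.
    move=> [x y] [x' y'] /=; rewrite inE => /andP[/mP /= m _].
    rewrite inE => /andP[/mP /= m' _] E; rewrite -E in m' *.
    by rewrite mate_sym in m; rewrite mate_sym in m'; rewrite (mate_uniq m m').
  apply: subset_leq_card; apply/subsetP => _ /imsetP[[x y] xy ->] /=.
  by move: xy; rewrite inE => /andP[/mP /= m /andP[/= xA yB]]; apply: sub m.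
have c1 := m1 I I (matched I); have c2 := m1 (~: I) (~: I) (matched (~: I)).
have c3 := m1 (~: I) I crossing; have c4 := m2 I (~: I) crossing.
have {}c1 : #|[set xy in mates | (xy.1 \in I) && (xy.2 \in I)]| <= #|matched I|.
  by apply: c1 => x y xI yI xy; rewrite inE xI; apply/exists_inP; exists y.
have {}c2 : #|[set xy in mates | (xy.1 \in ~: I) && (xy.2 \in ~: I)]| <= #|matched (~: I)|.
  by apply: c2 => x y xI yI xy; rewrite inE xI; apply/exists_inP; exists y.
have {}c3 : #|[set xy in mates | (xy.1 \in ~: I) && (xy.2 \in I)]| <= #|crossing|.
  by apply: c3 => x y xI yI xy; rewrite inE xI; apply/exists_inP; exists y.
have {}c4 : #|[set xy in mates | (xy.1 \in I) && (xy.2 \in ~: I)]| <= #|crossing|.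
  apply: c4 => x y xI yI xy; rewrite inE yI; apply/exists_inP; exists x => //.
  by rewrite mate_sym.
have split_mates : #|mates| <=
    #|[set xy in mates | (xy.1 \in I) && (xy.2 \in I)]|
    + #|[set xy in mates | (xy.1 \in ~: I) && (xy.2 \in ~: I)]|
    + (#|[set xy in mates | (xy.1 \in ~: I) && (xy.2 \in I)]|
      + #|[set xy in mates | (xy.1 \in I) && (xy.2 \in ~: I)]|).
  apply: leq_trans (leq_add (leq_card_setU _ _) (leq_card_setU _ _)).
  apply: leq_trans (leq_card_setU _ _); apply: subset_leq_card.
  apply/subsetP => xy; rewrite !inE => -> /=.
  by case: (rest v0 xy.1); case: (rest v0 xy.2).
apply: leq_trans split_mates _; rewrite mul2n -addnn.
by apply: leq_add; apply: leq_add.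
Qed.

(** Each of the three summands of the hypothesis, times the minimum, is at most [2 * p], and [mates]
    is at most six times their sum. *)
Lemma mates_many : 0 < #|matched I| - 2 + (#|matched (~: I)| - 2) + #|crossing| ->
  minn D (n - D) * #|mates| <= 36 * p.
Proof.
have := card_mates_le; have := matched_nbr_le; have := matched_nonnbr_le.
have := crossing_le.
have ar (L d1 d2 P vi vr c mm : nat) : L <= d1 -> L <= d2 ->
    d1 * c <= 2 * P -> d1 * vr <= 2 * d1 + 2 * P -> d2 * vi <= 2 * d2 + 2 * P ->
    mm <= vi + vr + 2 * c -> 0 < vi - 2 + (vr - 2) + c -> L * mm <= 36 * P.
  move=> L1 L2 hc hr hi hm pos.
  have hi' : L * (vi - 2) <= 2 * P.
    apply: leq_trans (leq_mul L2 (leqnn _)) _.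
    by rewrite mulnBr leq_subLR (mulnC d2 2).
  have hr' : L * (vr - 2) <= 2 * P.
    apply: leq_trans (leq_mul L1 (leqnn _)) _.
    by rewrite mulnBr leq_subLR (mulnC d1 2).
  have hc' : L * c <= 2 * P by apply: leq_trans (leq_mul L1 (leqnn _)) hc.
  (* Undoing the truncated subtractions adds at most 4, which a positive sum absorbs: twice the sum
     plus 4 is at most six times the sum. *)
  apply: leq_trans (_ : L * (6 * (vi - 2 + (vr - 2) + c)) <= _).
    by rewrite leq_mul2l; lia.
  have -> : L * (6 * (vi - 2 + (vr - 2) + c))
      = 6 * (L * (vi - 2) + L * (vr - 2) + L * c) by lia.
  lia.
by apply: ar; [exact: geq_minl | exact: geq_minr].
Qed.

Lemma card_mates_leT : #|mates| <= n.
Proof.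
rewrite -(@card_in_imset _ _ fst); first exact: max_card.
have mP xy : xy \in mates -> mate xy.1 xy.2.
  by rewrite inE rest_or_mate => /andP[/orP[->|]].
move=> [x y] [x' y'] /mP /= m /mP /= m' E; rewrite -E in m' *.
by rewrite (mate_uniq m m').
Qed.

Lemma matched_two (A : {set T}) x y u v : #|matched A| <= 2 ->
  x \in A -> y \in A -> mate x y -> u \in A -> v \in A -> mate u v ->
  (u = x /\ v = y) \/ (u = y /\ v = x).
Proof.
move=> c2 xA yA xy uA vA uv.
have in_m z w : z \in A -> w \in A -> mate z w -> z \in matched A.
  by move=> zA wA zw; rewrite inE zA; apply/exists_inP; exists w.
have sub : [set x; y] \subset matched A.
  apply/subsetP => z /set2P[] ->; first exact: in_m xy.
  by apply: (in_m _ x) => //; rewrite mate_sym.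
have /eqP E : [set x; y] == matched A.
  by rewrite eqEcard sub cards2 (mate_neq xy).
have : u \in matched A by exact: in_m uv.
rewrite -E => /set2P[] uE; [left | right]; split=> //.
  by apply: (@mate_uniq x); rewrite // -uE.
by apply: (@mate_uniq y); [rewrite -uE | rewrite mate_sym].
Qed.

(** Otherwise every vertex of [B] other than [x'] and [y'] misses [x] or [y], which gives at least
    [#|B| - 2] missing pairs. *)
Lemma common_nbr (A B : {set T}) x y x' y' : x \in A -> y \in A ->
  \sum_(r in B) missing rest A r < #|B| - 2 ->
  exists r, [/\ r \in B, r != x', r != y', rest r x & rest r y].
Proof.
move=> xA yA small.
have [/existsP[r /and5P[*]]|/existsPn none] := boolP [exists r,
    [&& r \in B, r != x', r != y', rest r x & rest r y]]; first by exists r.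
suff : #|B| - 2 <= \sum_(r in B) missing rest A r by rewrite leqNgt small.
apply: leq_trans (_ : #|B :\: [set x'; y']| <= _).
  rewrite cardsD leq_sub2l //; apply: leq_trans (subset_leq_card (subsetIr _ _)) _.
  by rewrite cards2; case: eqP.
rewrite -sum1_card big_mkcond [leqRHS]big_mkcond; apply: leq_sum => r _.
rewrite in_setD; case: ifP => // /andP[rN rB]; rewrite rB.
rewrite in_set2 negb_or in rN; case/andP: rN => rx' ry'.
have := none r; rewrite rB rx' ry' /= negb_and => nr.
apply/card_gt0P; case/orP: nr => nr; [exists x | exists y]; rewrite inE nr ?xA ?yA //.
Qed.

(** Adjacency of [x] to both [x'] and [y'] would give a 2-fan centred at [x], with triangles [x y r]
    and [x x' y']. *)
Lemma no_K4 x y x' y' r : mate x y -> mate x' y' -> rest r x -> rest r y ->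
  r != x' -> r != y' -> x != x' -> x != y' -> y != x' -> y != y' ->
  ~~ (e x x' && e x y').
Proof.
move=> xy x'y' /andP[rx _] /andP[ry _] rx' ry' xx' xy' yx' yy'.
apply/negP => /andP[exx' exy'].
have nr w : e r w -> w != r by apply: contraTneq => ->; rewrite e_irr.
case/andP: (xy) (x'y') => exy _ /andP[ex'y' _].
have exr : e x r by rewrite e_sym.
have eyr : e y r by rewrite e_sym.
apply: (e_fan _ exy exr eyr exx' exy' ex'y').
by rewrite /= !inE !negb_or (mate_neq xy) (mate_neq x'y') xx' xy' yx' yy' rx' ry' !nr.
Qed.

(** The pair [xy] need not be an edge, so bipartite graphs are covered as well. *)
Definition one_edge_split (P : {set T}) (x y : T) :=
  [/\ x \in P, y \in P, x != y,
      forall u v, u \in P -> v \in P -> e u v ->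
        (u = x /\ v = y) \/ (u = y /\ v = x)
    & forall u v, u \notin P -> v \notin P -> ~~ e u v].

Definition two_edge_split (P : {set T}) (x y x' y' : T) :=
  [/\ [/\ x \in P, y \in P & x != y], [/\ x' \notin P, y' \notin P & x' != y'],
      ~~ e x x' /\ ~~ e y y',
      forall u v, u \in P -> v \in P -> e u v ->
        (u = x /\ v = y) \/ (u = y /\ v = x)
    & forall u v, u \notin P -> v \notin P -> e u v ->
        (u = x' /\ v = y') \/ (u = y' /\ v = x')].

(** By [mates_many] each side contains at most one matching edge and none crosses. Then [p] is below
    [D], so [rest] has no edge outside [I] either, and all edges inside the two sides are matching
    edges. *)
Lemma few_mates_split : 3 <= minn D (n - D) ->
  36 * p < minn D (n - D) * #|mates| ->
  exists P : {set T}, [/\ minn D (n - D) <= #|P|, minn D (n - D) <= n - #|P| &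
    (exists x y, one_edge_split P x y) \/
    (n - #|P| <= #|P| /\ exists x y x' y', two_edge_split P x y x' y')].
Proof.
set L := minn _ _ => L3 few.
have LD : L <= D by exact: geq_minl.
have LnD : L <= n - D by exact: geq_minr.
have Dn : D <= n by exact: max_card.
have nD : n - (n - D) = D by rewrite subKn.
have [cI cR cX] : [/\ #|matched I| <= 2, #|matched (~: I)| <= 2 & #|crossing| = 0].
  suff : #|matched I| - 2 + (#|matched (~: I)| - 2) + #|crossing| = 0.
    by move/eqP; rewrite !addn_eq0 !subn_eq0 -andbA => /and3P[-> -> /eqP].
  apply/eqP; rewrite -leqn0 leqNgt; apply/negP => /mates_many.
  by rewrite leqNgt few.
(* At most four ordered pairs remain in [mates], and 36 divided by 4 is 9. *)
have small : 9 * p < L.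
  have ar (mm P c1 c2 c3 : nat) : 36 * P < L * mm -> mm <= c1 + c2 + 2 * c3 ->
      c1 <= 2 -> c2 <= 2 -> c3 = 0 -> 9 * P < L.
    move=> h1 h2 h3 h4 h5; have : L * mm <= L * 4 by rewrite leq_mul2l; lia.
    lia.
  exact: ar few card_mates_le cI cR cX.
have pL : p < L - 2.
  have ar (q l : nat) : 9 * q < l -> 3 <= l -> q < l - 2 by lia.
  exact: ar small L3.
have eI u v : u \in I -> v \in I -> e u v -> mate u v.
  by move=> uI vI; rewrite rest_or_mate rest_nbr.
have restR u v : u \in ~: I -> v \in ~: I -> rest u v = false.
  rewrite !in_setC => uI vI; apply/negP => uv.
  have ar (q l d : nat) : 9 * q < l -> l <= d -> d <= q -> False by lia.
  exact: ar small LD (rest_nonnbr_le uI vI uv).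
have eR u v : u \in ~: I -> v \in ~: I -> e u v -> mate u v.
  by move=> uI vI; rewrite rest_or_mate restR.
have cardR : #|~: I| = n - D by exact: card_nonnbr.
have inC u : (u \notin I) = (u \in ~: I) by rewrite in_setC.
have inCC u : (u \notin ~: I) = (u \in I) by rewrite in_setC negbK.
have noM (A : {set T}) u v : matched A = set0 -> u \in A -> v \in A -> ~~ mate u v.
  move=> mA uA vA; apply/negP => uv.
  suff : u \in matched A by rewrite mA inE.
  by rewrite inE uA; apply/exists_inP; exists v.
have exM (A : {set T}) : matched A != set0 -> exists x y, [/\ x \in A, y \in A & mate x y].
  by case/set0Pn => x; rewrite inE => /andP[xA /exists_inP[y yA xy]]; exists x, y.
have [mR|/exM[x' [y' [x'R y'R xy']]]] := eqVneq (matched (~: I)) set0.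
  exists I; split=> //; left.
  (* If neither side has an edge, any two vertices of [I] may serve as ends of the extra edge. *)
  have [mI|/exM[x [y [xI yI xy]]]] := eqVneq (matched I) set0.
    have /card_gt1P[x [y [xI yI xy]]] : 1 < #|I|.
      by apply: leq_trans LD; apply: leq_trans L3.
    exists x, y; split=> // u v.
      by move=> uI vI /(eI _ _ uI vI) uv; have := noM _ u v mI uI vI; rewrite uv.
    by rewrite !inC => uI vI; apply: contra (noM _ u v mR uI vI); exact: eR.
  exists x, y; split; rewrite ?mate_neq // => u v.
    move=> uI vI /(eI _ _ uI vI); exact: matched_two cI xI yI xy uI vI.
  by rewrite !inC => uI vI; apply: contra (noM _ u v mR uI vI); exact: eR.
have [mI|/exM[x [y [xI yI xy]]]] := eqVneq (matched I) set0.
  exists (~: I); rewrite cardR nD; split=> //; left.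
  exists x', y'; split; rewrite ?mate_neq // => u v.
    move=> uI vI /(eR _ _ uI vI); exact: matched_two cR x'R y'R xy' uI vI.
  by rewrite !inCC => uI vI; apply: contra (noM _ u v mI uI vI); exact: eI.
have neq u v : u \in I -> v \in ~: I -> u != v.
  by move=> uI; apply: contraTneq => <-; rewrite in_setC uI.
have [r [rR rx' ry' rx ry]] : exists r,
    [/\ r \in ~: I, r != x', r != y', rest r x & rest r y].
  apply: (@common_nbr I) => //; rewrite cardR; apply: leq_trans pL _.
  exact: leq_sub2r.
have [w [wI wx wy wx' wy']] : exists w,
    [/\ w \in I, w != x, w != y, rest w x' & rest w y'].
  apply: (@common_nbr (~: I)) => //; rewrite sum_missing_nbr; apply: leq_trans pL _.
  exact: leq_sub2r.
have yx : mate y x by rewrite mate_sym.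
have yx' : mate y' x' by rewrite mate_sym.
have k1 : ~~ (e x x' && e x y') by apply: (no_K4 xy xy' rx ry) => //; exact: neq.
have k2 : ~~ (e y x' && e y y') by apply: (no_K4 yx xy' ry rx) => //; exact: neq.
have k3 : ~~ (e x' x && e x' y).
  by apply: (no_K4 xy' xy wx' wy') => //; rewrite eq_sym; exact: neq.
have k4 : ~~ (e y' x && e y' y).
  by apply: (no_K4 yx' xy wy' wx') => //; rewrite eq_sym; exact: neq.
rewrite !(e_sym x') in k3; rewrite !(e_sym y') in k4.
(* By [k1] to [k4] no end of either edge is adjacent to both ends of the other, so one of the two
   pairings of [x], [y] with [x'], [y'] consists of non-adjacent pairs. *)
have [s [t [sR tR st [xs yt]]]] : exists s t,
    [/\ s \in ~: I, t \in ~: I, mate s t & ~~ e x s /\ ~~ e y t].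
  have [h|h] := boolP (~~ e x x' && ~~ e y y').
    by case/andP: h => h1 h2; exists x', y'.
  exists y', x'; split=> //.
  by move: k1 k2 k3 k4 h; case: (e x x'); case: (e x y'); case: (e y x'); case: (e y y').
have eI2 u v : u \in I -> v \in I -> e u v -> (u = x /\ v = y) \/ (u = y /\ v = x).
  move=> uI vI /(eI _ _ uI vI); exact: matched_two cI xI yI xy uI vI.
have eR2 u v : u \in ~: I -> v \in ~: I -> e u v -> (u = s /\ v = t) \/ (u = t /\ v = s).
  move=> uI vI /(eR _ _ uI vI); exact: matched_two cR sR tR st uI vI.
(* The larger side becomes [P]. *)
have [le|/ltnW le] := leqP (n - D) D.
  exists I; split=> //; right; split=> //; exists x, y, s, t.
  split; rewrite ?inC ?(mate_neq xy) ?(mate_neq st) //.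
  by move=> u v; rewrite !inC; exact: eR2.
exists (~: I); rewrite cardR nD; split=> //; right; split=> //; exists s, t, x, y.
split; rewrite ?inCC ?(mate_neq xy) ?(mate_neq st) //.
  by rewrite !(e_sym _ x) !(e_sym _ y).
by move=> u v; rewrite !inCC; exact: eI2.
Qed.

End Structure.

(** * One extra edge in each part *)

Lemma exp_le_ffact x j : (x - j) ^ j <= x ^_ j.
Proof.
elim: j x => [|j IH] x //; rewrite ffactnS expnS leq_mul ?leq_subr //.
by apply: leq_trans (IH x.-1); apply: leq_expl; lia.
Qed.

(** An integer form of Bernoulli's inequality, by induction with one factor [x] split into [x - j]
    and [j]. *)
Lemma exp_sub_ge x j k : x ^ k.+1 <= (x - j) ^ k.+1 + k.+1 * j * x ^ k.
Proof.
elim: k => [|k IH]; first by rewrite !expn1 expn0; lia.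
rewrite expnS; apply: leq_trans (leq_mul (leqnn x) IH) _.
have h : x * (x - j) ^ k.+1 <= (x - j) ^ k.+2 + j * x ^ k.+1.
  have le : (x - j) ^ k.+1 <= x ^ k.+1 by apply: leq_expl; lia.
  apply: leq_trans (_ : (x - j + j) * (x - j) ^ k.+1 <= _).
    by rewrite leq_mul2r; apply/orP; right; lia.
  by rewrite mulnDl -expnS leq_add2l leq_mul2l le orbT.
rewrite mulnDr; have -> : x * (k.+1 * j * x ^ k) = k.+1 * j * x ^ k.+1.
  by rewrite expnS; lia.
have -> : k.+2 * j * x ^ k.+1 = j * x ^ k.+1 + k.+1 * j * x ^ k.+1 by lia.
by rewrite addnA leq_add2r.
Qed.

Lemma leq_phi a b x y x' y' : x <= x' -> y <= y' -> phi a b x y <= phi a b x' y'.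
Proof. by move=> xx yy; rewrite leq_mul // leq_ffact //; lia. Qed.

Lemma exp_le_phi a b x : (x - (a + b).+1) ^ (a + b) <= phi a b x x.
Proof.
rewrite expnD leq_mul //.
  by apply: leq_trans (exp_le_ffact _ _); apply: leq_expl; lia.
by apply: leq_trans (exp_le_ffact _ _); apply: leq_expl; lia.
Qed.

(** One [gsum] absorbs [2 * phi a b r r]. The other absorbs twice the difference between
    [i ^ (a + b)] and [i ^_ (a + b)], which has lower order because [r] is linear in [n]. *)
Lemma two_edges_estimate a b C n r i : 0 < C -> 0 < a + b -> r <= i -> i <= n ->
  n <= C * (r - (a + b).+1) -> 2 * (a + b) ^ 2 * C ^ (a + b) <= n ->
  2 * phi a b r r + 2 * phi a b i i <= 2 * gsum a b r i + 2 * i ^_ (a + b).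
Proof.
move=> C0 k0 ri iin nC n0.
have h1 : 2 * phi a b r r <= gsum a b r i.
  by rewrite mul2n -addnn leq_add // leq_phi.
have h2 : (r - (a + b).+1) ^ (a + b) <= gsum a b r i.
  apply: leq_trans (exp_le_phi _ _ _) _; apply: leq_trans h1.
  by rewrite mul2n -addnn leq_addr.
have h3 : phi a b i i <= i ^ (a + b) by exact: phi_le_exp.
have h4 := exp_le_ffact i (a + b).
move: (a + b) k0 nC n0 h2 h3 h4 => k k0 nC n0 h2 h3 h4.
case: k k0 nC n0 h2 h3 h4 => // k _ nC n0 h2 h3 h4.
have h5 := exp_sub_ge i k.+1 k.
have h6 : 2 * (k.+1 * k.+1 * i ^ k) <= (r - k.+2) ^ k.+1.
  have Ck : 0 < C ^ k.+1 by rewrite expn_gt0 C0.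
  rewrite -(leq_pmul2l Ck) -expnMn.
  apply: leq_trans (leq_expl _ nC).
  apply: leq_trans (_ : n * i ^ k <= _).
    apply: leq_trans (leq_mul n0 (leqnn _)); rewrite -mulnn.
    by move: (C ^ k.+1) (i ^ k) => X Y; apply: eq_leq; lia.
  by rewrite expnS leq_mul // leq_expl.
move: h1 h2 h3 h4 h5 h6.
move: (phi a b r r) (gsum a b r i) (phi a b i i) (i ^_ k.+1) => A B X Y.
move: (i ^ k.+1) ((i - k.+1) ^ k.+1) ((r - k.+2) ^ k.+1) => X1 X2 X3.
move: (k.+1 * k.+1 * i ^ k) => X4; lia.
Qed.

Lemma sum_set_bound (I : finType) (A : {set I}) (F : I -> nat) c m :
  #|A| <= m -> (forall x, x \in A -> F x <= c) -> \sum_(x in A) F x <= m * c.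
Proof.
move=> Am Fc; apply: leq_trans (_ : \sum_(x in A) c <= _); first exact: leq_sum.
by rewrite sum_nat_const leq_mul2r Am orbT.
Qed.

Lemma sum_setU_le (I : finType) (A B : {set I}) (F : I -> nat) :
  \sum_(x in A :|: B) F x <= \sum_(x in A) F x + \sum_(x in B) F x.
Proof.
rewrite big_mkcond [X in _ <= X + _]big_mkcond [X in _ <= _ + X]big_mkcond.
rewrite -big_split /=; apply: leq_sum => x _; rewrite in_setU.
by case: (x \in A); case: (x \in B) => //=; rewrite ?leq_addr ?addn0.
Qed.

Lemma card_setX_minus2 (T : finType) (A B : {set T}) x y x' y' :
  x \in A -> y \in A -> x' \in B -> y' \in B -> x != y ->
  #|setX A B :\ (x, x') :\ (y, y')| = #|A| * #|B| - 2.
Proof.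
move=> xA yA xB yB xy.
have yx : (y, y') != (x, x') by rewrite xpair_eqE eq_sym (negPf xy).
have := cardsD1 (x, x') (setX A B); rewrite cardsX in_setX xA xB /= => ->.
have := cardsD1 (y, y') (setX A B :\ (x, x')).
by rewrite in_setD1 yx in_setX yA yB /= => ->; rewrite !add1n subSS subSS subn0.
Qed.

(** Inside [P], [x] gains at most the neighbour [y] but loses [x'] outside, and likewise for [y] and
    [y']; other vertices of [P] have no neighbour in [P]. *)
Lemma deg_split_le (T : finType) (e : rel T) (P : {set T}) x y x' y' u :
  irreflexive e -> x' \notin P -> y' \notin P -> ~~ e x x' -> ~~ e y y' ->
  (forall u v, u \in P -> v \in P -> e u v ->
     (u = x /\ v = y) \/ (u = y /\ v = x)) ->
  u \in P -> deg e u <= #|~: P|.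
Proof.
move=> e_irr x'P y'P xx' yy' eP uP.
have aux v w : w \notin P -> ~~ e u w ->
    (forall z, z \in P -> e u z -> z = v) -> deg e u <= #|~: P|.
  move=> wP uw uv; rewrite (cardsD1 w (~: P)) in_setC wP add1n.
  apply: leq_trans (_ : #|v |: (~: P) :\ w| <= _); last first.
    by rewrite cardsU1 -add1n leq_add2r leq_b1.
  apply: subset_leq_card; apply/subsetP => z; rewrite inE => uz.
  rewrite !inE; have [zP|zP] := boolP (z \in P); first by rewrite (uv z) ?eqxx.
  by rewrite andbT; apply/orP; right; apply: contraNneq uw => <-.
have [ux|ux] := eqVneq u x.
  apply: (aux y x') => //; first by rewrite ux.
  move=> z zP uz; case: (eP _ _ uP zP uz) => -[E1 E2] //.
  by rewrite E2 -ux e_irr in uz.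
have [uy|uy] := eqVneq u y.
  apply: (aux x y') => //; first by rewrite uy.
  move=> z zP uz; case: (eP _ _ uP zP uz) => -[E1 E2] //.
  by rewrite E1 eqxx in ux.
apply: subset_leq_card; apply/subsetP => z; rewrite !inE => uz.
apply/negP => zP; case: (eP _ _ uP zP uz) => -[E _].
  by rewrite E eqxx in ux.
by rewrite E eqxx in uy.
Qed.

(** Degrees do not exceed those of the complete bipartite graph. The two missing cross edges save
    [2 * gsum], and the inner edges cost the two [phi] terms. *)
Lemma star_count_two_edge_split a b (T : finType) (e : rel T)
    (P : {set T}) x y x' y' :
  symmetric e -> irreflexive e ->
  two_edge_split e P x y x' y' ->
  star_count a b e + 2 * gsum a b #|~: P| #|P|
    <= #|~: P| * #|P| * gsum a b #|~: P| #|P|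
       + (2 * phi a b #|~: P| #|~: P| + 2 * phi a b #|P| #|P|).
Proof.
move=> e_sym e_irr [[xP yP xy] [x'P y'P xy'] [xx' yy'] eP eC].
set r := #|~: P|; set i := #|P|.
have dP u : u \in P -> deg e u <= r by exact: deg_split_le xx' yy' eP.
have dC u : u \notin P -> deg e u <= i.
  rewrite -in_setC (_ : i = #|~: ~: P|); last by rewrite setCK.
  apply: (@deg_split_le _ _ _ x' y' x y) => //; rewrite ?in_setC ?negbK //.
  - by rewrite e_sym.
  - by rewrite e_sym.
  - by move=> v w; rewrite !in_setC; exact: eC.
pose F (uv : T * T) := phi a b (deg e uv.1) (deg e uv.2).
pose PP := [set (x, y); (y, x)]; pose CC := [set (x', y'); (y', x')].
pose PC := setX P (~: P) :\ (x, x') :\ (y, y').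
pose CP := setX (~: P) P :\ (x', x) :\ (y', y).
have x'C : x' \in ~: P by rewrite in_setC.
have y'C : y' \in ~: P by rewrite in_setC.
have le0 : star_count a b e <= \sum_(uv in (PP :|: CC) :|: (PC :|: CP)) F uv.
  apply: leq_trans (star_count_le _ _ e_sym) _.
  rewrite pair_big_dep /= big_mkcond [leqRHS]big_mkcond; apply: leq_sum => -[u v] _ /=.
  case: ifP => // uv; rewrite ifT // /PP /CC /PC /CP.
  rewrite !in_setU !in_setD1 !in_setX !in_set1 !in_setC.
  have [uP|uP] := boolP (u \in P); have [vP|vP] := boolP (v \in P).
  - by case: (eP _ _ uP vP uv) => -[-> ->]; rewrite eqxx ?orbT.
  - have -> : (u, v) != (y, y') by apply: contraTneq uv => -[-> ->].
    have -> : (u, v) != (x, x') by apply: contraTneq uv => -[-> ->].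
    by rewrite /= ?orbT.
  - have -> : (u, v) != (y', y) by apply: contraTneq uv => -[-> ->]; rewrite e_sym.
    have -> : (u, v) != (x', x) by apply: contraTneq uv => -[-> ->]; rewrite e_sym.
    by rewrite /= ?orbT.
  - by case: (eC _ _ uP vP uv) => -[-> ->]; rewrite eqxx ?orbT.
have lePP : \sum_(uv in PP) F uv <= 2 * phi a b r r.
  apply: sum_set_bound => [|uv /set2P[] ->]; first by rewrite cards2; case: eqP.
    by apply: leq_phi; apply: dP.
  by apply: leq_phi; apply: dP.
have leCC : \sum_(uv in CC) F uv <= 2 * phi a b i i.
  apply: sum_set_bound => [|uv /set2P[] ->]; first by rewrite cards2; case: eqP.
    by apply: leq_phi; apply: dC.
  by apply: leq_phi; apply: dC.
have lePC : \sum_(uv in PC) F uv <= (i * r - 2) * phi a b r i.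
  apply: sum_set_bound => [|[u v]]; first by rewrite card_setX_minus2.
  rewrite !in_setD1 in_setX in_setC => /and4P[_ _ uP vP].
  by apply: leq_phi; [exact: dP | exact: dC].
have leCP : \sum_(uv in CP) F uv <= (r * i - 2) * phi a b i r.
  apply: sum_set_bound => [|[u v]]; first by rewrite card_setX_minus2.
  rewrite !in_setD1 in_setX in_setC => /and4P[_ _ uP vP].
  by apply: leq_phi; [exact: dC | exact: dP].
have ri : 2 <= r * i.
  have i2 : 1 < i by apply/card_gt1P; exists x, y.
  have r1 : 0 < r by apply/card_gt0P; exists x'.
  by apply: leq_trans i2 _; rewrite leq_pmull.
apply: leq_trans (leq_add (leq_trans le0 (leq_trans (sum_setU_le _ _ _)
  (leq_add (sum_setU_le _ _ _) (sum_setU_le _ _ _)))) (leqnn _)) _.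
apply: leq_trans (leq_add (leq_add (leq_add lePP leCC) (leq_add lePC leCP)) (leqnn _)) _.
rewrite (mulnC i r) /gsum.
have ar (m s t A B : nat) : 2 <= m -> A + B + ((m - 2) * s + (m - 2) * t)
    + 2 * (s + t) <= m * (s + t) + (A + B).
  move=> m2; have -> : m * (s + t) = (m - 2) * (s + t) + 2 * (s + t).
    by rewrite -mulnDl subnK.
  by rewrite mulnDr; lia.
exact: ar.
Qed.

(** The extra edge of the comparison graph lies in the smaller part, so its leaves range over the
    larger one. *)
Lemma star_count_two_edge_le a b C (T : finType) (e : rel T) (P : {set T}) x y x' y' :
  symmetric e -> irreflexive e ->
  two_edge_split e P x y x' y' -> 0 < C -> 0 < a + b ->
  #|T| - #|P| <= #|P| -> 2 <= #|T| - #|P| ->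
  #|T| <= C * (#|T| - #|P| - (a + b).+1) ->
  2 * (a + b) ^ 2 * C ^ (a + b) <= #|T| ->
  star_count a b e <=
    star_count a b (adj (bipartite_plus (#|T| - #|P|) (#|T| - (#|T| - #|P|)))).
Proof.
move=> e_sym e_irr split C0 k0 le r2 nC n0.
have Pn : #|P| <= #|T| by exact: max_card.
have cC : #|~: P| = #|T| - #|P| by rewrite cardsCs setCK.
have := star_count_two_edge_split a b e_sym e_irr split.
have := two_edges_estimate C0 k0 le Pn nC n0.
have := star_count_bipartite_plus_ge a b (#|T| - (#|T| - #|P|)) r2.
rewrite cC subKn //.
move: (gsum _ _ _ _) (#|P| ^_ _) (phi a b #|P| _) (phi _ _ _ _) => g f p1 p2.
move: (star_count a b e) (star_count _ _ _) (_ * _ * g) => w1 w2 h; lia.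
Qed.

(** * The extremal bound *)

Lemma bipartite_plus_max a b n : 2 < n -> exists m, [/\ 2 <= m, m < n &
  forall m', 2 <= m' -> m' < n ->
    star_count a b (adj (bipartite_plus m' (n - m')))
      <= star_count a b (adj (bipartite_plus m (n - m)))].
Proof.
move=> n2; pose f (m : 'I_n) := star_count a b (adj (bipartite_plus m (n - m))).
have [m m2 mmax] := @arg_maxnP _ (Ordinal n2) (fun m : 'I_n => 2 <= m) f isT.
by exists m; split=> // m' m'2 m'n; have := mmax (Ordinal m'n); apply.
Qed.

(** For [x = 1] the count vanishes because a star contains no double star with leaves at both
    centres; for [x = 0] and [x = n] there are no edges. *)
Lemma bipartite_count_le_max a b n B : 0 < a -> 0 < b ->
  (forall m, 2 <= m -> m < n ->
     star_count a b (adj (bipartite_plus m (n - m))) <= B) ->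
  forall x, x <= n -> x * (n - x) * gsum a b x (n - x) <= B.
Proof.
move=> a0 b0 maxB x xn; have [x2|x2] := leqP 2 x; last first.
  have phi1 c d y : 0 < c -> 0 < d -> phi c d 1 y = 0 /\ phi c d y 1 = 0.
    by move=> c0 d0; rewrite /phi !ffact0n !gtn_eqF // muln0.
  case: x x2 xn => [|[|//]] _ _; first by rewrite !mul0n.
  have [p1 p2] := phi1 a b (n - 1) a0 b0.
  by rewrite /gsum p1 p2 muln0.
have [xn'|nx] := ltnP x n; last by rewrite (_ : n - x = 0) ?muln0 //; lia.
apply: leq_trans (maxB _ x2 xn').
by apply: leq_trans (star_count_bipartite_plus_ge a b _ x2); rewrite leq_addr.
Qed.

(** Evaluated at the balanced split; the hypothesis on [n] is what makes [n./2 - (a + b).+1] at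
    least a quarter of [n]. *)
Lemma bipartite_count_large a b n B : 4 * (a + b) + 6 <= n ->
  (forall x, x <= n -> x * (n - x) * gsum a b x (n - x) <= B) ->
  n ^ (a + b).+2 <= 4 ^ (a + b).+2 * B.
Proof.
move=> n_ge HB; pose h := n./2.
have hn : h <= n by rewrite /h; lia.
have hh : h <= n - h by rewrite /h; lia.
have n4 : n <= 4 * (h - (a + b).+1) by rewrite /h; lia.
apply: leq_trans (leq_mul (leqnn _) (HB h hn)).
apply: leq_trans (leq_expl _ n4) _; rewrite expnMn leq_mul2l; apply/orP; right.
rewrite !expnS mulnA; apply: leq_mul; first by rewrite leq_mul //; lia.
apply: leq_trans (exp_le_phi a b h) _.
apply: leq_trans (leq_addr (phi a b (n - h) h) _); exact: leq_phi.
Qed.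

Lemma max_deg_vertex (T : finType) (e : rel T) : 0 < #|T| ->
  exists v, forall u, deg e u <= deg e v.
Proof.
case/card_gt0P => x _; have [v _ vmax] := @arg_maxnP _ x predT (deg e) isT.
by exists v => u; apply: vmax.
Qed.

(** The surplus of [W] over [W0] is outweighed by the deficit [p * B]: here [p] is at least
    [L * mm / 36], [L] at least [n / (4 * K)] and [B] at least [n ^ k.+2 / K]. The product of the
    constants is [144 * K * K]. *)
Lemma heavy_estimate k K n L z p mm B W W0 :
  0 < n -> 0 < z -> z <= n -> 0 < K -> 432 * K * K * k.+1 <= n ->
  n ^ k.+2 <= K * B -> n <= 4 * K * L -> L * mm <= 36 * p ->
  W <= W0 + k.+1 * mm * n ^ k -> 3 * n * z * W0 + p * B <= 3 * n * z * B ->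
  W <= B.
Proof.
move=> n0 z0 zn K0 nbig KB nL Lm WW0 def.
have c0 : 0 < 3 * n * z by rewrite !muln_gt0 n0 z0.
rewrite -(leq_pmul2l c0); apply: leq_trans def.
apply: leq_trans (leq_mul (leqnn _) WW0) _; rewrite mulnDr leq_add2l.
have K2 : 0 < 144 * K * K by rewrite !muln_gt0 K0.
rewrite -(leq_pmul2l K2).
apply: leq_trans (_ : n * mm * n ^ k.+2 <= _).
  apply: leq_trans (_ : 432 * K * K * k.+1 * (n * z * mm * n ^ k) <= _).
    by move: (n ^ k) => X; apply: eq_leq; lia.
  apply: leq_trans (leq_mul nbig (leqnn _)) _.
  rewrite -!mulnA leq_mul2l; apply/orP; right.
  rewrite !expnS; move: (n ^ k) => X.
  apply: leq_trans (_ : n * (n * (mm * X)) <= _); last by apply: eq_leq; lia.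
  by rewrite leq_mul2l leq_mul2r zn !orbT.
apply: leq_trans (leq_mul (leqnn _) KB) _.
apply: leq_trans (_ : 4 * K * (L * mm) * (K * B) <= _).
  rewrite leq_mul2r; apply/orP; right.
  by apply: leq_trans (leq_mul nL (leqnn mm)) _; apply: eq_leq; lia.
apply: leq_trans (_ : 4 * K * (36 * p) * (K * B) <= _).
  by rewrite leq_mul2r leq_mul2l Lm !orbT.
by apply: eq_leq; lia.
Qed.

(** Both [W0] and the surplus are at most half of [n ^ k.+2 / K]. *)
Lemma sparse_estimate k K n L mm B W W0 :
  0 < K -> 2 * K * k.+1 <= n -> n ^ k.+2 <= K * B -> 4 * K * L <= n -> mm <= n ->
  W <= W0 + k.+1 * mm * n ^ k -> W0 <= 2 * n * L * n ^ k -> W <= B.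
Proof.
move=> K0 nbig KB Ln mn WW0 W0L.
rewrite -(leq_pmul2l K0); apply: leq_trans KB.
rewrite -(leq_pmul2l (isT : 0 < 2)).
apply: leq_trans (_ : 4 * K * L * (n * n ^ k) + 2 * K * k.+1 * (n * n ^ k) <= _).
  apply: leq_trans (_ : 2 * (K * (2 * n * L * n ^ k + k.+1 * n * n ^ k)) <= _).
    rewrite !leq_mul2l /=; apply/orP; right.
    apply: leq_trans WW0 (leq_add W0L _).
    by rewrite leq_mul2r leq_mul2l mn !orbT.
  by move: (n ^ k) => X; apply: eq_leq; lia.
rewrite -mulnDl !expnS; apply: leq_trans (_ : (n + n) * (n * n ^ k) <= _).
  by rewrite leq_mul2r leq_add ?orbT.
by rewrite addnn -mul2n -mulnA.
Qed.

Lemma star_count_extremal a b : 0 < a -> 0 < b ->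
  exists n0, forall (T : finType) (e : rel T), n0 <= #|T| ->
    symmetric e -> irreflexive e -> fan_free e ->
    exists m, [/\ 2 <= m, m < #|T| & star_count a b e
      <= star_count a b (adj (bipartite_plus m (#|T| - m)))].
Proof.
move=> a0 b0; pose k := a + b; pose K := 4 ^ k.+2.
have K0 : 0 < K by rewrite expn_gt0.
(* Each summand is the threshold of one of the estimates below; adding them stands in for a
   maximum. *)
exists (4 * k + 6 + 2 * K * k.+1 + 432 * K * K * k.+1
  + 4 * K * (2 * k + 4) + 2 * k ^ 2 * (8 * K) ^ k).
move=> T e; set n := #|T| => n_ge e_sym e_irr e_fan.
have [n1 n2 n3 n4 n5] : [/\ 4 * k + 6 <= n, 2 * K * k.+1 <= n, 432 * K * K * k.+1 <= n,
    4 * K * (2 * k + 4) <= n & 2 * k ^ 2 * (8 * K) ^ k <= n].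
  move: n_ge; move: (4 * k + 6) (2 * K * k.+1) (432 * K * K * k.+1) => A1 A2 A3.
  move: (4 * K * (2 * k + 4)) (2 * k ^ 2 * (8 * K) ^ k) => A4 A5 le.
  by split; lia.
have n0 : 0 < n by apply: leq_trans n1; rewrite addnS.
have n_gt2 : 2 < n by apply: leq_trans n1; rewrite !addnS.
have [m [m2 mn mmax]] := bipartite_plus_max a b n_gt2.
set B := star_count _ _ _ in mmax.
have HB := bipartite_count_le_max a0 b0 mmax.
have KB : n ^ k.+2 <= K * B by exact: bipartite_count_large.
have done_B : star_count a b e <= B -> exists m, [/\ 2 <= m, m < n &
    star_count a b e <= star_count a b (adj (bipartite_plus m (n - m)))].
  by move=> le; exists m.
have [M [M_hits M_priv M_match]] := triangle_matching e_sym e_irr e_fan.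
have [v0 v0_max] := max_deg_vertex (rest e M) n0.
have r_sym := rest_sym M e_sym; have r_tf := rest_tf M_hits.
have pert : star_count a b e <= star_count a b (rest e M)
    + k.+1 * #|mates e M| * n ^ k by exact: star_count_perturb.
set D := deg (rest e M) v0 in v0_max.
have [sparse|dense] := leqP (4 * K * minn D (n - D)) n.
  apply: done_B; apply: sparse_estimate K0 n2 KB sparse _ pert _.
    exact: card_mates_leT.
  exact: star_count_le_min.
set L := minn D (n - D) in dense.
have L_ge : 2 * k + 4 <= L.
  have K4 : 0 < 4 * K by rewrite muln_gt0 K0.
  by apply: ltnW; rewrite -(ltn_pmul2l K4); apply: leq_ltn_trans dense.
have L3 : 3 <= L by apply: leq_trans L_ge; rewrite !addnS.
have LnD : L <= n - D by exact: geq_minr.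
have Dn : D <= n by exact: max_card.
have [heavy|few] := leqP (L * #|mates e M|)
    (36 * \sum_(r in ~: [set w | rest e M v0 w]) missing (rest e M) [set w | rest e M v0 w] r).
  apply: done_B.
  apply: heavy_estimate n0 _ (leq_subr D n) K0 n3 KB (ltnW dense) heavy pert _.
    by apply: leq_trans LnD; apply: leq_trans L3.
  exact: star_count_deficit.
have [P [LP LC [[x [y [xP yP xy eP eC]]]|[le [x [y [x' [y' split]]]]]]]] :=
  few_mates_split e_sym e_irr e_fan M_hits M_priv M_match L3 few.
  exists #|P|; split.
  - by apply: leq_trans LP; apply: leq_trans L3.
  - by rewrite -subn_gt0; apply: leq_trans LC; apply: leq_trans L3.
  - apply: star_count_le_bipartite_plus eP eC => //.
    by apply: leq_trans LC; apply: leq_trans L3.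
exists (n - #|P|); split.
- by apply: leq_trans LC; apply: leq_trans L3.
- by rewrite ltn_subrL n0 andbT; apply: leq_trans LP; apply: leq_trans L3.
(* Density gives [n <= 4 * K * r] for the smaller part [r], and [r >= 2 * k + 4] gives
   [r <= 2 * (r - k.+1)]; hence the factor 8. *)
- apply: (star_count_two_edge_le (C := 8 * K) e_sym e_irr split) => //.
  + by rewrite muln_gt0 K0.
  + by rewrite addn_gt0 a0.
  + by apply: leq_trans LC; apply: leq_trans L3.
  + rewrite -/n -/k; apply: leq_trans (ltnW dense) _.
    apply: leq_trans (leq_mul (leqnn _) LC) _.
    move: (n - #|P|) (leq_trans L_ge LC) => r rk.
    have ar (c s t : nat) : s <= 2 * t -> 4 * c * s <= 8 * c * t.
      by move=> st; apply: leq_trans (leq_mul (leqnn _) st) _; apply: eq_leq; lia.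
    by apply: ar; lia.
Qed.

Theorem theorem1p4 (a b : nat) (ha : 0 < a) (hb : 0 < b) :
  exists n0 : nat, forall n : nat, n0 <= n ->
    exists m : nat, [/\ 2 <= m, m < n &
      ex_copies n (double_star a b) two_fan =
        num_copies (double_star a b) (bipartite_plus m (n - m))].
Proof.
have [n0 extremal] := star_count_extremal ha hb.
exists (n0 + 3) => n n_ge.
have n2 : 2 < n by lia.
have [m [m2 mn mmax]] := bipartite_plus_max a b n2.
exists m; split=> //; apply/eqP; rewrite eqn_leq; apply/andP; split.
  apply/bigmax_leqP => G freeG; apply: num_copies_double_star_le.
  have n0I : n0 <= #|'I_n| by rewrite card_ord; lia.
  have [m' [m'2 m'n le]] : exists m', [/\ 2 <= m', m' < #|'I_n| &
      star_count a b (adj G) <=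
        star_count a b (adj (bipartite_plus m' (#|'I_n| - m')))].
    apply: extremal n0I (@adj_sym _ G) (@adj_irr _ G) _.
    by move=> z x y x' y'; exact: graph_free_two_fan.
  rewrite card_ord in m'n le.
  by apply: leq_trans le _; apply: mmax.
(* For attainment, the extremal graph is transported to the vertex set ['I_n]. *)
have [h [g hK gK]] : {h : 'I_n -> 'I_m + 'I_(n - m) | bijective h}.
  by apply: card_eq_bij; rewrite card_sum !card_ord subnKC // ltnW.
pose G : sgraph 'I_n :=
  graph_of_rel (fun x y => adj (bipartite_plus m (n - m)) (h x) (h y)).
have adjG x y : adj G x y = adj (bipartite_plus m (n - m)) (h x) (h y).
  rewrite adj_graph_of_rel [X in _ || X]adj_sym orbb; apply: andb_idl.
  by apply: contraTneq => ->; rewrite adj_irr.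
have freeG : graph_free two_fan G.
  apply: two_fan_graph_free => z x y x' y' u; rewrite !adjG.
  apply: bipartite_plus_no_two_fan.
  rewrite -[[:: _; _; _; _; _]]/(map h [:: z; x; y; x'; y']) map_inj_uniq //.
  exact: can_inj hK.
rewrite /ex_copies; apply: leq_trans (leq_bigmax_cond _ freeG).
apply: num_copies_double_star_le; apply: (@star_count_mono _ _ _ _ _ _ g).
  exact: can_inj gK.
by move=> x y; rewrite adjG !gK.
Qed.
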